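(* Let $X$ be a Hilbert space and let $V$ be a closed convex body in $X$ (not necessarily bounded) with $S=\partial V$ a $C^1$ submanifold, so that the outer unit normal $N_S:S\to S_X$ is well defined. Let $L>0$. The following statements are equivalent: (1) $N_S$ is $L$-Lipschitz. (2) For every $0<r<1/L$ and every $x\in S$ there exists a closed ball $B(z,r)\subseteq V$ with $\partial B(z,r)\cap S=\{x\}$. (3) $\langle N_S(y),y-x\rangle\ge \tfrac{1}{2L}\|N_S(x)-N_S(y)\|^2$ for all $x,y\in S$. (4) There exists a convex function $F:X\to\mathbb{R}$ of class $C^{1,1}$ with $\operatorname{lip}(\nabla F)\le L$, $S=F^{-1}(1)$ and $\nabla F(x)=N_S(x)$ for every $x\in S$. Furthermore, if $V$ is bounded and $0\in\operatorname{int}(V)$, then the following statement is equivalent to the existence of some $L>0$ for which (1)–(4) hold: (5) for every $\alpha>0$, the Minkowski functional $\mu_V$ is of class $C^{1,1}$ on the set $\{x\in X:\mu_V(x)\ge\alpha\}$, i.e. $\mu_V$ is differentiable there and $\nabla\mu_V$ is Lipschitz on that set.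
   Context: A convex body is a closed convex set with nonempty interior (possibly unbounded). A function $F:X\to\mathbb{R}$ is of class $C^{1,1}$ if it is differentiable and $\nabla F$ is globally Lipschitz; $\operatorname{lip}(\cdot)$ denotes the Lipschitz constant. For $0\in\operatorname{int}(V)$, the Minkowski functional is $\mu_V(x)=\inf\{t>0: x/t\in V\}$. *)

(* Defs.v *)
From Stdlib Require Import Reals Lra ClassicalEpsilon.
Open Scope R_scope.
Set Implicit Arguments.

Record HilbertSpace := {
  hcarrier :> Type;
  vzero : hcarrier;
  vadd : hcarrier -> hcarrier -> hcarrier;
  vopp : hcarrier -> hcarrier;
  vscal : R -> hcarrier -> hcarrier;
  inner : hcarrier -> hcarrier -> R;
  vadd_assoc : forall x y z, vadd x (vadd y z) = vadd (vadd x y) z;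
  vadd_comm : forall x y, vadd x y = vadd y x;
  vadd_0 : forall x, vadd vzero x = x;
  vadd_opp : forall x, vadd (vopp x) x = vzero;
  vscal_1 : forall x, vscal 1 x = x;
  vscal_assoc : forall a b x, vscal a (vscal b x) = vscal (a * b) x;
  vscal_distr_r : forall a b x, vscal (a + b) x = vadd (vscal a x) (vscal b x);
  vscal_distr_l : forall a x y, vscal a (vadd x y) = vadd (vscal a x) (vscal a y);
  inner_sym : forall x y, inner x y = inner y x;
  inner_add_l : forall x y z, inner (vadd x y) z = inner x z + inner y z;
  inner_scal_l : forall a x y, inner (vscal a x) y = a * inner x y;
  inner_pos : forall x, 0 <= inner x x;
  inner_def : forall x, inner x x = 0 -> x = vzero;
  hcomplete : forall u : nat -> hcarrier,
    (forall eps, 0 < eps -> exists N, forall n m, (N <= n)%nat -> (N <= m)%nat ->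
        sqrt (inner (vadd (u n) (vopp (u m))) (vadd (u n) (vopp (u m)))) < eps) ->
    exists l, forall eps, 0 < eps -> exists N, forall n, (N <= n)%nat ->
        sqrt (inner (vadd (u n) (vopp l)) (vadd (u n) (vopp l))) < eps
}.

Arguments vzero {h}.
Arguments vadd {h}.
Arguments vopp {h}.
Arguments vscal {h}.
Arguments inner {h}.

Section Defs.
Context {X : HilbertSpace}.

Definition vsub (x y : X) : X := vadd x (vopp y).
Definition norm (x : X) : R := sqrt (inner x x).

Definition cball (z : X) (r : R) (y : X) : Prop := norm (vsub y z) <= r.
Definition sphere (z : X) (r : R) (y : X) : Prop := norm (vsub y z) = r.

Definition is_closed (V : X -> Prop) : Prop :=
  forall x, (forall eps, 0 < eps -> exists y, V y /\ norm (vsub x y) < eps) -> V x.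
Definition int_set (V : X -> Prop) (x : X) : Prop :=
  exists eps, 0 < eps /\ forall y, norm (vsub y x) < eps -> V y.
Definition closure_set (V : X -> Prop) (x : X) : Prop :=
  forall eps, 0 < eps -> exists y, V y /\ norm (vsub x y) < eps.
Definition bdry (V : X -> Prop) (x : X) : Prop := closure_set V x /\ ~ int_set V x.

Definition convex_set (V : X -> Prop) : Prop :=
  forall x y t, V x -> V y -> 0 <= t <= 1 ->
    V (vadd (vscal t x) (vscal (1 - t) y)).
Definition convex_body (V : X -> Prop) : Prop :=
  is_closed V /\ convex_set V /\ exists x, int_set V x.
Definition bounded_set (V : X -> Prop) : Prop :=
  exists M, forall x, V x -> norm x <= M.

Definition convex_fun (F : X -> R) : Prop :=
  forall x y t, 0 <= t <= 1 ->
    F (vadd (vscal t x) (vscal (1 - t) y)) <= t * F x + (1 - t) * F y.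

Definition has_gradient (F : X -> R) (x g : X) : Prop :=
  forall eps, 0 < eps -> exists delta, 0 < delta /\
    forall h, norm h < delta ->
      Rabs (F (vadd x h) - F x - inner g h) <= eps * norm h.

Definition C1_hypersurface (S : X -> Prop) : Prop :=
  forall x, S x -> exists delta (phi : X -> R) (G : X -> X), 0 < delta /\
    (forall y, norm (vsub y x) < delta -> has_gradient phi y (G y)) /\
    (forall y, norm (vsub y x) < delta -> forall eps, 0 < eps -> exists d, 0 < d /\
        forall w, norm (vsub w x) < delta -> norm (vsub w y) < d ->
          norm (vsub (G w) (G y)) < eps) /\
    G x <> vzero /\
    (forall y, norm (vsub y x) < delta -> (S y <-> phi y = 0)).

Definition outer_unit_normal (V : X -> Prop) (x n : X) : Prop :=
  norm n = 1 /\ forall y, V y -> inner n (vsub y x) <= 0.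

Definition is_inf (E : R -> Prop) (m : R) : Prop :=
  (forall t, E t -> m <= t) /\ (forall b, (forall t, E t -> b <= t) -> b <= m).

Definition Inf (E : R -> Prop) : R :=
  match excluded_middle_informative (exists m, is_inf E m) with
  | left H => proj1_sig (constructive_indefinite_description _ H)
  | right _ => 0
  end.

Definition minkowski (V : X -> Prop) (x : X) : R :=
  Inf (fun t => 0 < t /\ V (vscal (/ t) x)).

End Defs.

Section Conditions.
Context {X : HilbertSpace}.
Variables (V : X -> Prop) (N : X -> X) (L : R).

Definition cond1 : Prop := forall x y, bdry V x -> bdry V y ->
  norm (vsub (N x) (N y)) <= L * norm (vsub x y).
Definition cond2 : Prop := forall r, 0 < r < / L -> forall x, bdry V x ->
  exists z, (forall y, cball z r y -> V y) /\
            (forall y, (sphere z r y /\ bdry V y) <-> y = x).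
Definition cond3 : Prop := forall x y, bdry V x -> bdry V y ->
  inner (N y) (vsub y x) >= / (2 * L) * (norm (vsub (N x) (N y))) ^ 2.
Definition cond4 : Prop := exists (F : X -> R) (G : X -> X),
  convex_fun F /\
  (forall x, has_gradient F x (G x)) /\
  (forall x y, norm (vsub (G x) (G y)) <= L * norm (vsub x y)) /\
  (forall x, bdry V x <-> F x = 1) /\
  (forall x, bdry V x -> G x = N x).
End Conditions.

Definition cond5 {X : HilbertSpace} (V : X -> Prop) : Prop :=
  forall alpha, 0 < alpha ->
    exists (G : X -> X) (K : R),
      (forall x, minkowski V x >= alpha -> has_gradient (minkowski V) x (G x)) /\
      (forall x y, minkowski V x >= alpha -> minkowski V y >= alpha ->
         norm (vsub (G x) (G y)) <= K * norm (vsub x y)).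

(* Main.v *)
(* For [0 <= r], let [C_r] be the set of centres of the balls of radius [r] contained in [V].
   As [V] is the intersection of its supporting half-spaces, the inclusion of the ball of centre
   [x - r N(x)] in [V] for all boundary points [x] means that
   [r (1 - <N x, N y>) <= <N y, y - x>] for all [x], [y]; hence (2) and (3) are equivalent, and
   (3) gives (1) by symmetrization.

   (1) implies (3): suppose this inequality holds for some [r < 1/L]. Then every [w] outside
   [C_r] projects onto [C_r] at a point [x - r N(x)] with normal [N(x)], and these points
   determine [N] with Lipschitz constant [1 / (1/L - r)]. A point [w] outside [C_r] therefore
   cannot lie in the ball of radius [(1/L - r)/2] touching [C_r] from inside at [x - r N(x)], so
   the inequality improves to [r + (1/L - r)/2]. Starting from [r = 0], which is the convexity of
   [V], and iterating, one reaches [1/L] in the limit. Smoothness of the boundary only enters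
   through the uniqueness of the unit normals.

   (3) implies (4) with [F = L/2 dist(., C_(1/L))^2 + 1 - 1/(2L)], and (4) implies (3) because a
   convex function with [L]-Lipschitz gradient is cocoercive.

   The gradient of the Minkowski functional at [x] is [N(p) / <N(p), p>] with
   [p = x / mu(x)], which transfers Lipschitz estimates between [N] and the gradient of [mu]. *)

Require Import Defs.
From Stdlib Require Import Reals Ranalysis5 Lra Lia Psatz Classical ClassicalEpsilon.
Open Scope R_scope.

(** * Elementary facts on real numbers, choice and infima *)

(** If [a > 0] then also [b > 0], and [t = min(1, a / (2 b))] yields [a <= a / 2]. Serves to let [t]
    tend to [0] in first-order conditions. *)
Lemma le0_of_scaled (a b : R) : (forall t, 0 < t <= 1 -> a <= t * b) -> a <= 0.
Proof.
  intros H. destruct (Rle_dec a 0) as [|Ha]; [assumption|exfalso].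
  apply Rnot_le_lt in Ha.
  assert (Hb : 0 < b) by (specialize (H 1); lra).
  assert (Hq : 0 < a / (2 * b)) by (apply Rdiv_lt_0_compat; lra).
  pose proof (H (Rmin 1 (a / (2 * b)))) as H1.
  assert (Hm : 0 < Rmin 1 (a / (2 * b))) by (apply Rmin_glb_lt; lra).
  pose proof (Rmin_l 1 (a / (2 * b))). pose proof (Rmin_r 1 (a / (2 * b))).
  assert (Rmin 1 (a / (2 * b)) * b <= a / (2 * b) * b)
    by (apply Rmult_le_compat_r; lra).
  replace (a / (2 * b) * b) with (a / 2) in * by (field; lra).
  specialize (H1 (conj Hm H0)). lra.
Qed.

Lemma Rabs_le_inv (a b : R) : Rabs a <= b -> - b <= a <= b.
Proof. intros H. unfold Rabs in H. destruct (Rcase_abs a); lra. Qed.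

Lemma choice_fun (A B : Type) (Q : A -> B -> Prop) :
  (forall a, exists b, Q a b) -> exists f : A -> B, forall a, Q a (f a).
Proof.
  intros H.
  exists (fun a => proj1_sig (constructive_indefinite_description _ (H a))).
  intros a. exact (proj2_sig (constructive_indefinite_description _ (H a))).
Qed.

Lemma glb_exists (E : R -> Prop) (c : R) :
  (exists t, E t) -> (forall t, E t -> c <= t) -> exists m, is_inf E m.
Proof.
  intros [t0 H0] Hc.
  destruct (completeness (fun s => E (- s))) as [m [Hub Hlub]].
  - exists (- c). intros s Hs. apply Hc in Hs. lra.
  - exists (- t0). now rewrite Ropp_involutive.
  - exists (- m). split.
    + intros t Ht. enough (- t <= m) by lra. apply Hub. now rewrite Ropp_involutive.
    + intros b Hb. enough (m <= - b) by lra.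
      apply Hlub. intros s Hs. apply Hb in Hs. lra.
Qed.

(** * Algebra of the inner product, and tactics for scalar and vector identities *)

Section InnerProduct.
Context {X : HilbertSpace}.
Implicit Types x y z u v w : X.

Lemma inner_add_r x y z : inner x (vadd y z) = inner x y + inner x z.
Proof. now rewrite !(inner_sym X x), inner_add_l. Qed.

Lemma inner_scal_r a x y : inner x (vscal a y) = a * inner x y.
Proof. now rewrite !(inner_sym X x), inner_scal_l. Qed.

Lemma inner_zero_l x : inner vzero x = 0.
Proof.
  pose proof (inner_add_l X vzero vzero x) as H. rewrite vadd_0 in H. lra.
Qed.

Lemma inner_zero_r x : inner x vzero = 0.
Proof. now rewrite inner_sym, inner_zero_l. Qed.

Lemma inner_opp_l x y : inner (vopp x) y = - inner x y.
Proof.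
  pose proof (inner_add_l X (vopp x) x y) as H.
  rewrite vadd_opp, inner_zero_l in H. lra.
Qed.

Lemma inner_opp_r x y : inner x (vopp y) = - inner x y.
Proof. now rewrite !(inner_sym X x), inner_opp_l. Qed.

Lemma inner_sub_l x y z : inner (vsub x y) z = inner x z - inner y z.
Proof. unfold vsub. rewrite inner_add_l, inner_opp_l. lra. Qed.

Lemma inner_sub_r x y z : inner x (vsub y z) = inner x y - inner x z.
Proof. unfold vsub. rewrite inner_add_r, inner_opp_r. lra. Qed.

End InnerProduct.

(** The second loop merges [inner b a] with [inner a b], so that [ring] and [lra] see a single atom;
    excluding equal arguments prevents it from looping on squares. *)
Ltac expand_inner :=
  repeat (rewrite ?inner_add_l, ?inner_add_r, ?inner_scal_l, ?inner_scal_r,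
    ?inner_opp_l, ?inner_opp_r, ?inner_sub_l, ?inner_sub_r, ?inner_zero_l, ?inner_zero_r);
  repeat match goal with
  | |- context [@inner ?H ?a ?b] =>
      match goal with
      | |- context [@inner H b a] =>
          tryif constr_eq a b then fail else rewrite (inner_sym H b a)
      end
  end.

Section Extensionality.
Context {X : HilbertSpace}.
Implicit Types x y z u v w : X.

Lemma vsub_eq0 x y : vsub x y = vzero -> x = y.
Proof.
  unfold vsub. intros H. rewrite <- (vadd_0 X y), <- H, <- vadd_assoc, vadd_opp.
  now rewrite vadd_comm, vadd_0.
Qed.

Lemma inner_sub_eq0 x y : inner (vsub x y) (vsub x y) <= 0 -> x = y.
Proof.
  intros H. apply vsub_eq0, inner_def. pose proof (inner_pos X (vsub x y)). lra.
Qed.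

(** Test against [w = vsub x y]. Vector identities thus reduce to real ones, which is how
    [vector_eq] works. *)
Lemma inner_ext x y : (forall w, inner x w = inner y w) -> x = y.
Proof.
  intros H. apply inner_sub_eq0. rewrite inner_sub_l, H. lra.
Qed.

End Extensionality.

Ltac vector_eq :=
  apply inner_ext; intro;
  repeat (rewrite ?inner_add_l, ?inner_scal_l, ?inner_opp_l, ?inner_sub_l, ?inner_zero_l);
  try (field; lra).

(** * Norm, Cauchy-Schwarz inequality and projection onto closed convex sets *)

Section Norm.
Context {X : HilbertSpace}.
Implicit Types x y z u v w : X.

Lemma norm_ge0 x : 0 <= norm x.
Proof. apply sqrt_pos. Qed.

Lemma norm_sqr x : norm x * norm x = inner x x.
Proof. apply sqrt_sqrt, inner_pos. Qed.

Lemma norm_le_sqr x c : 0 <= c -> inner x x <= c * c -> norm x <= c.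
Proof. intros Hc H. rewrite <- (sqrt_square c Hc). now apply sqrt_le_1_alt. Qed.

Lemma sqr_le_norm x c : 0 <= c -> c * c <= inner x x -> c <= norm x.
Proof. intros Hc H. rewrite <- (sqrt_square c Hc). now apply sqrt_le_1_alt. Qed.

Lemma norm_zero : norm (vzero : X) = 0.
Proof. unfold norm. rewrite inner_zero_l. apply sqrt_0. Qed.

Lemma norm_pos x : x <> vzero -> 0 < norm x.
Proof.
  intros H. destruct (norm_ge0 x) as [|H0]; [assumption|].
  contradict H. apply inner_def. rewrite <- norm_sqr, <- H0. lra.
Qed.

(** The square of [|y| x - |x| y] equals [2 |x| |y| (|x| |y| - <x, y>)]; zero vectors are treated
    apart. *)
Lemma cauchy_schwarz x y : inner x y <= norm x * norm y.
Proof.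
  destruct (classic (y = vzero)) as [->|Hy].
  - rewrite inner_zero_r, norm_zero. lra.
  - apply norm_pos in Hy.
    pose proof (inner_pos X (vsub (vscal (norm y) x) (vscal (norm x) y))) as H.
    revert H. expand_inner. rewrite <- !norm_sqr. intros H.
    pose proof (norm_ge0 x) as [Hx|Hx].
    + assert (0 <= 2 * (norm x * norm y) * (norm x * norm y - inner x y)) by nra.
      assert (0 < norm x * norm y) by nra. nra.
    + assert (x = vzero) as -> by (apply inner_def; rewrite <- norm_sqr, <- Hx; lra).
      rewrite inner_zero_l, norm_zero. lra.
Qed.

Lemma norm_scal a x : norm (vscal a x) = Rabs a * norm x.
Proof.
  unfold norm. expand_inner.
  replace (a * (a * inner x x)) with ((a * a) * inner x x) by ring.
  rewrite sqrt_mult_alt by nra. f_equal. apply sqrt_Rsqr_abs.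
Qed.

Lemma norm_opp x : norm (vopp x) = norm x.
Proof. unfold norm. expand_inner. f_equal. lra. Qed.

Lemma norm_sub_sym x y : norm (vsub x y) = norm (vsub y x).
Proof. unfold norm. f_equal. expand_inner. lra. Qed.

Lemma norm_triangle x y : norm (vadd x y) <= norm x + norm y.
Proof.
  pose proof (norm_ge0 x). pose proof (norm_ge0 y).
  apply norm_le_sqr; [lra|]. pose proof (cauchy_schwarz x y).
  expand_inner. rewrite <- !norm_sqr. nra.
Qed.

Lemma norm_sub_triangle x y z : norm (vsub x z) <= norm (vsub x y) + norm (vsub y z).
Proof.
  replace (vsub x z) with (vadd (vsub x y) (vsub y z)) by vector_eq.
  apply norm_triangle.
Qed.

Lemma cauchy_schwarz_abs x y : Rabs (inner x y) <= norm x * norm y.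
Proof.
  apply Rabs_le. split; [|apply cauchy_schwarz].
  pose proof (cauchy_schwarz (vopp x) y) as H. rewrite norm_opp, inner_opp_l in H. lra.
Qed.

(** The equality case of Cauchy-Schwarz: [|v - r n|^2 = 2 r (r - <n, v>) <= 0]. *)
Lemma aligned_eq (v n : X) r :
  norm v = r -> inner n n = 1 -> r <= inner n v -> v = vscal r n.
Proof.
  intros Hv Hn H. pose proof (norm_ge0 v) as H0. apply inner_sub_eq0.
  assert (E : inner (vsub v (vscal r n)) (vsub v (vscal r n)) =
    norm v * norm v - 2 * r * inner n v + r * r * inner n n)
    by (rewrite norm_sqr; expand_inner; ring).
  rewrite E, Hn, Hv. rewrite Hv in H0. nra.
Qed.

Lemma is_closed_bdry (V : X -> Prop) x : is_closed V -> bdry V x -> V x.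
Proof. intros HV [H _]. now apply HV. Qed.

Lemma supported_bdry (V : X -> Prop) p n :
  V p -> n <> vzero -> (forall y, V y -> inner n (vsub y p) <= 0) -> bdry V p.
Proof.
  intros Hp Hn Hs. split.
  - intros eps He. exists p. split; [assumption|].
    replace (vsub p p) with (vzero : X) by vector_eq. now rewrite norm_zero.
  - intros [e [He H]]. apply norm_pos in Hn.
    pose proof (Rdiv_lt_0_compat e (2 * norm n) He ltac:(lra)) as Hs0.
    set (s := e / (2 * norm n)) in *.
    assert (Hy : V (vadd p (vscal s n))).
    { apply H. replace (vsub (vadd p (vscal s n)) p) with (vscal s n) by vector_eq.
      rewrite norm_scal, Rabs_pos_eq by lra. unfold s.
      replace (e / (2 * norm n) * norm n) with (e / 2) by (field; lra). lra. }
    apply Hs in Hy. revert Hy. expand_inner. rewrite <- norm_sqr.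
    assert (0 < s * (norm n * norm n)) by (apply Rmult_lt_0_compat; nra). lra.
Qed.

(** A minimizing sequence for the distance is Cauchy by the parallelogram law. The variational
    inequality follows by comparing the limit [p] with [t y + (1 - t) p] and letting [t] tend to
    [0]. *)
Theorem projection_exists (C : X -> Prop) w :
  is_closed C -> convex_set C -> (exists x, C x) ->
  exists p, C p /\ forall y, C y -> inner (vsub w p) (vsub y p) <= 0.
Proof.
  intros Hcl Hcv [x0 Hx0].
  destruct (glb_exists (fun s => exists y, C y /\ s = norm (vsub w y)) 0) as [s [Hs1 Hs2]].
  { now exists (norm (vsub w x0)), x0. }
  { intros t [y [_ ->]]. apply norm_ge0. }
  assert (Hs0 : 0 <= s) by (apply Hs2; intros t [y [_ ->]]; apply norm_ge0).
  assert (Hlow : forall y, C y -> s <= norm (vsub w y)) by (intros y Hy; apply Hs1; now exists y).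
  destruct (choice_fun nat X (fun n y => C y /\ norm (vsub w y) < s + / INR (S n))) as [u Hu].
  { intros n. apply NNPP. intros Hn.
    assert (Hi : 0 < / INR (S n)) by (apply Rinv_0_lt_compat, lt_0_INR; lia).
    assert (s + / INR (S n) <= s); [|lra]. apply Hs2. intros t [y [Hy ->]].
    apply Rnot_lt_le. intros Hlt. apply Hn. now exists y. }
  destruct (hcomplete X u) as [p Hp].
  { intros eps He.
    assert (Hd : 0 < eps * eps / (8 * s + 5)) by (apply Rdiv_lt_0_compat; nra).
    (* Chosen so that [4 (s + d)^2 - 4 s^2 = 8 s d + 4 d^2 < d (8 s + 5) <= eps^2], the first
       inequality using [d <= 1]. *)
    set (d := Rmin 1 (eps * eps / (8 * s + 5))).
    assert (Hd0 : 0 < d) by (apply Rmin_glb_lt; lra).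
    assert (Hd1 : d <= 1) by apply Rmin_l.
    assert (Hd2 : d * (8 * s + 5) <= eps * eps).
    { replace (eps * eps) with (eps * eps / (8 * s + 5) * (8 * s + 5)) by (field; lra).
      apply Rmult_le_compat_r; [lra|apply Rmin_r]. }
    destruct (archimed_cor1 d Hd0) as [K [HK HK0]].
    exists K.
    assert (Hclose : forall n, (K <= n)%nat -> norm (vsub w (u n)) <= s + d).
    { intros n Hn. destruct (Hu n) as [_ H].
      assert (/ INR (S n) <= / INR K).
      { apply Rinv_le_contravar; [apply lt_0_INR; lia|apply le_INR; lia]. }
      lra. }
    intros n m Hn Hm.
    assert (Hmid := Hlow (vadd (vscal (/2) (u n)) (vscal (1 - /2) (u m)))
      (Hcv _ _ (/2) (proj1 (Hu n)) (proj1 (Hu m)) ltac:(lra))).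
    pose proof (Hclose n Hn) as Hcn. pose proof (Hclose m Hm) as Hcm.
    pose proof (Hlow _ (proj1 (Hu n))). pose proof (Hlow _ (proj1 (Hu m))).
    fold (vsub (u n) (u m)). fold (norm (vsub (u n) (u m))).
    assert (Hsq : inner (vsub (u n) (u m)) (vsub (u n) (u m)) < eps * eps).
    { set (q := vadd (vscal (/2) (u n)) (vscal (1 - /2) (u m))) in *.
      (* Parallelogram law; the midpoint [q] lies in [C], hence at distance at least [s] from
         [w]. *)
      assert (Hpar : inner (vsub (u n) (u m)) (vsub (u n) (u m)) =
        2 * (norm (vsub w (u n)) * norm (vsub w (u n)))
        + 2 * (norm (vsub w (u m)) * norm (vsub w (u m)))
        - 4 * (norm (vsub w q) * norm (vsub w q))).
      { rewrite !norm_sqr. unfold q. expand_inner. field. }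
      assert (s * s <= norm (vsub w q) * norm (vsub w q)) by nra.
      assert (norm (vsub w (u n)) * norm (vsub w (u n)) <= (s + d) * (s + d)) by nra.
      assert (norm (vsub w (u m)) * norm (vsub w (u m)) <= (s + d) * (s + d)) by nra.
      nra. }
    rewrite <- norm_sqr in Hsq. pose proof (norm_ge0 (vsub (u n) (u m))). nra. }
  change (forall eps, 0 < eps -> exists K, forall n, (K <= n)%nat -> norm (vsub (u n) p) < eps)
    in Hp.
  assert (HCp : C p).
  { apply Hcl. intros eps He. destruct (Hp eps He) as [K HK]. exists (u K).
    split; [apply Hu|]. rewrite norm_sub_sym. now apply HK. }
  assert (Hsp : norm (vsub w p) <= s).
  { apply le_epsilon. intros e He.
    destruct (Hp (e / 2)) as [K HK]; [lra|].
    destruct (archimed_cor1 (e / 2)) as [J [HJ HJ0]]; [lra|].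
    pose proof (HK (max K J) ltac:(lia)).
    destruct (Hu (max K J)) as [_ Hn].
    assert (/ INR (S (max K J)) <= / INR J).
    { apply Rinv_le_contravar; [apply lt_0_INR; lia|apply le_INR; lia]. }
    pose proof (norm_sub_triangle w (u (max K J)) p). lra. }
  exists p. split; [assumption|]. intros y Hy.
  enough (2 * inner (vsub w p) (vsub y p) <= 0) by lra.
  apply (le0_of_scaled _ (inner (vsub y p) (vsub y p))). intros t Ht.
  pose proof (Hlow _ (Hcv y p t Hy HCp ltac:(lra))) as Hq.
  assert (Hq2 : norm (vsub w p) * norm (vsub w p) <=
    norm (vsub w (vadd (vscal t y) (vscal (1 - t) p))) *
    norm (vsub w (vadd (vscal t y) (vscal (1 - t) p)))).
  { pose proof (norm_ge0 (vsub w p)). nra. }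
  rewrite !norm_sqr in Hq2.
  assert (Hexp : inner (vsub w (vadd (vscal t y) (vscal (1 - t) p)))
     (vsub w (vadd (vscal t y) (vscal (1 - t) p))) =
     inner (vsub w p) (vsub w p) - t * (2 * inner (vsub w p) (vsub y p))
     + t * t * inner (vsub y p) (vsub y p)) by (expand_inner; ring).
  rewrite Hexp in Hq2. nra.
Qed.

End Norm.

(** * Gradients, convex functions and Lipschitz gradients *)

Section Gradient.
Context {X : HilbertSpace}.
Implicit Types x y z u v w g : X.

Lemma line_derivative (F : X -> R) x v g t :
  has_gradient F (vadd x (vscal t v)) g ->
  derivable_pt_lim (fun s => F (vadd x (vscal s v))) t (inner g v).
Proof.
  intros H eps He. pose proof (norm_ge0 v) as Hv.
  (* The divisor is [norm v + 1] because [v] may be zero. *)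
  destruct (H (eps / (2 * (norm v + 1)))) as [d [Hd Hh]].
  { apply Rdiv_lt_0_compat; lra. }
  assert (Hd' : 0 < d / (norm v + 1)) by (apply Rdiv_lt_0_compat; lra).
  exists (mkposreal _ Hd'). simpl. intros h Hh0 Hhd.
  specialize (Hh (vscal h v)).
  replace (vadd (vadd x (vscal t v)) (vscal h v)) with (vadd x (vscal (t + h) v))
    in Hh by vector_eq.
  assert (Hlt : Rabs h * (norm v + 1) < d).
  { replace d with (d / (norm v + 1) * (norm v + 1)) by (field; lra).
    apply Rmult_lt_compat_r; lra. }
  pose proof (Rabs_pos_lt h Hh0) as Hp.
  rewrite norm_scal, inner_scal_r in Hh. specialize (Hh ltac:(nra)).
  replace ((F (vadd x (vscal (t + h) v)) - F (vadd x (vscal t v))) / h - inner g v)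
    with ((F (vadd x (vscal (t + h) v)) - F (vadd x (vscal t v)) - h * inner g v) / h)
    by (field; lra).
  unfold Rdiv. rewrite Rabs_mult, Rabs_inv.
  apply Rmult_lt_reg_r with (Rabs h); [lra|].
  rewrite Rmult_assoc, Rinv_l, Rmult_1_r by lra.
  eapply Rle_lt_trans; [exact Hh|].
  assert (eps / (2 * (norm v + 1)) * norm v < eps); [|nra].
  apply Rmult_lt_reg_r with (2 * (norm v + 1)); [lra|].
  replace (eps / (2 * (norm v + 1)) * norm v * (2 * (norm v + 1))) with (eps * norm v)
    by (field; lra). nra.
Qed.

(** Divide by [t] and let it decrease to [0]. Turns chord estimates, for convex functions and for
    the Minkowski functional, into bounds on the gradient. *)
Lemma gradient_upper_slope (F : X -> R) x g v c :
  has_gradient F x g ->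
  (forall t, 0 < t <= 1 -> F (vadd x (vscal t v)) <= F x + t * c) -> inner g v <= c.
Proof.
  intros H Hc. apply le_epsilon. intros e He.
  pose proof (norm_ge0 v) as Hv.
  destruct (H (e / (norm v + 1))) as [d [Hd Hh]]; [apply Rdiv_lt_0_compat; lra|].
  assert (Hd' : 0 < d / (norm v + 1)) by (apply Rdiv_lt_0_compat; lra).
  set (t := Rmin 1 (d / (norm v + 1) / 2)).
  assert (Ht : 0 < t) by (apply Rmin_glb_lt; lra).
  pose proof (Rmin_l 1 (d / (norm v + 1) / 2)) as Ht1.
  pose proof (Rmin_r 1 (d / (norm v + 1) / 2)) as Ht2. fold t in Ht1, Ht2.
  assert (Hlt : t * (norm v + 1) < d).
  { replace d with (d / (norm v + 1) * (norm v + 1)) by (field; lra).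
    apply Rmult_lt_compat_r; lra. }
  specialize (Hh (vscal t v)). rewrite norm_scal, inner_scal_r, Rabs_pos_eq in Hh by lra.
  specialize (Hh ltac:(nra)). specialize (Hc t (conj Ht Ht1)).
  apply Rabs_le_inv in Hh.
  assert (He1 : e / (norm v + 1) * norm v <= e).
  { apply Rmult_le_reg_r with (norm v + 1); [lra|].
    replace (e / (norm v + 1) * norm v * (norm v + 1)) with (e * norm v) by (field; lra).
    nra. }
  apply Rmult_le_reg_l with t; [lra|]. nra.
Qed.

Lemma convex_subgradient (F : X -> R) x y g :
  convex_fun F -> has_gradient F x g -> F x + inner g (vsub y x) <= F y.
Proof.
  intros HF Hg.
  enough (inner g (vsub y x) <= F y - F x) by lra.
  apply (gradient_upper_slope F x); [assumption|]. intros t Ht.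
  replace (vadd x (vscal t (vsub y x))) with (vadd (vscal t y) (vscal (1 - t) x))
    by vector_eq.
  specialize (HF y x t). lra.
Qed.

(** Mean value theorem for the difference between [F] along the segment and its quadratic majorant:
    at [c] the derivative is [<G(x + c v) - G(x), v> - L c |v|^2 <= 0]. *)
Lemma descent_bound (F : X -> R) (G : X -> X) L x v :
  (forall x, has_gradient F x (G x)) ->
  (forall x y, norm (vsub (G x) (G y)) <= L * norm (vsub x y)) ->
  F (vadd x v) <= F x + inner (G x) v + L / 2 * inner v v.
Proof.
  intros HG HL.
  set (phi := fun t => F (vadd x (vscal t v)) - (t * inner (G x) v + t * t * (L / 2 * inner v v))).
  destruct (MVT_cor2 phi
    (fun t => inner (G (vadd x (vscal t v))) v - (inner (G x) v + 2 * t * (L / 2 * inner v v))) 0 1)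
    as [c [Hc1 Hc2]]; [lra| |].
  { intros c _. apply derivable_pt_lim_minus; [now apply line_derivative|].
    (* The derivative in the shape produced by the sum and product rules. *)
    replace (inner (G x) v + 2 * c * (L / 2 * inner v v)) with
      ((1 * inner (G x) v + c * 0) + ((1 * c + c * 1) * (L / 2 * inner v v) + c * c * 0)) by ring.
    apply derivable_pt_lim_plus.
    - apply (derivable_pt_lim_mult id (fun _ => inner (G x) v));
        [apply derivable_pt_lim_id|apply derivable_pt_lim_const].
    - apply (derivable_pt_lim_mult (fun t => t * t) (fun _ => L / 2 * inner v v));
        [|apply derivable_pt_lim_const].
      apply (derivable_pt_lim_mult id id); apply derivable_pt_lim_id. }
  unfold phi in Hc1.
  replace (vadd x (vscal 1 v)) with (vadd x v) in Hc1 by vector_eq.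
  replace (vadd x (vscal 0 v)) with x in Hc1 by vector_eq.
  assert (Hd : inner (vsub (G (vadd x (vscal c v))) (G x)) v <= L * c * inner v v).
  { eapply Rle_trans; [apply cauchy_schwarz|].
    specialize (HL (vadd x (vscal c v)) x).
    replace (vsub (vadd x (vscal c v)) x) with (vscal c v) in HL by vector_eq.
    rewrite norm_scal, Rabs_pos_eq in HL by lra.
    rewrite <- norm_sqr. pose proof (norm_ge0 v). nra. }
  rewrite inner_sub_l in Hd. nra.
Qed.

(* Convexity at [y] against the descent bound at [x], both evaluated at [x - (G x - G y) / L]. *)
Lemma cocoercive_bound (F : X -> R) (G : X -> X) L x y :
  0 < L -> convex_fun F -> (forall x, has_gradient F x (G x)) ->
  (forall x y, norm (vsub (G x) (G y)) <= L * norm (vsub x y)) ->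
  F y + inner (G y) (vsub x y)
    + / (2 * L) * inner (vsub (G x) (G y)) (vsub (G x) (G y)) <= F x.
Proof.
  intros HL HF HG Hlip.
  set (v := vscal (- / L) (vsub (G x) (G y))).
  pose proof (descent_bound F G L x v HG Hlip) as H1.
  pose proof (convex_subgradient F y (vadd x v) (G y) HF (HG y)) as H2.
  set (q := inner (vsub (G x) (G y)) (vsub (G x) (G y))).
  assert (Hv : inner v v = / L * / L * q) by (unfold v; expand_inner; unfold q; expand_inner; ring).
  assert (Hg : inner (G x) v - inner (G y) v = - / L * q)
    by (unfold v; expand_inner; unfold q; expand_inner; ring).
  rewrite Hv in H1. rewrite inner_sub_r, inner_add_r in H2. rewrite inner_sub_r.
  replace (L / 2 * (/ L * / L * q)) with (/ (2 * L) * q) in H1 by (field; lra).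
  replace (- / L * q) with (- 2 * (/ (2 * L) * q)) in Hg by (field; lra). lra.
Qed.

End Gradient.

(** * Uniqueness of the outer unit normal at a [C1] boundary point *)

Section Normals.
Context {X : HilbertSpace}.
Implicit Types x y z u v w g n : X.

(* The boundary is the zero set of [phi]; moving by a first-order small amount along [g]
   changes the sign of [phi], so the intermediate value theorem gives a boundary point. *)
Lemma tangent_boundary_point (S : X -> Prop) (phi : X -> R) (G : X -> X) x delta t eta :
  0 < delta -> (forall y, norm (vsub y x) < delta -> has_gradient phi y (G y)) ->
  (forall y, norm (vsub y x) < delta -> (S y <-> phi y = 0)) ->
  S x -> G x <> vzero -> inner (G x) t = 0 -> 0 < eta ->
  exists s th, 0 < s /\ - eta <= th <= eta /\
    S (vadd x (vscal s (vadd t (vscal th (G x))))).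
Proof.
  intros Hd Hphi HS Sx HG Ht He. set (g := G x) in *.
  assert (Hxx : vsub x x = vzero) by vector_eq.
  assert (Hx0 : norm (vsub x x) < delta) by now rewrite Hxx, norm_zero.
  assert (phix : phi x = 0) by now apply HS.
  apply norm_pos in HG. pose proof (norm_ge0 t) as Htn.
  set (M := norm t + eta * norm g).
  assert (HM : 0 < M) by (unfold M; nra).
  assert (Hb : forall th, - eta <= th <= eta -> norm (vadd t (vscal th g)) <= M).
  { intros th Hth. eapply Rle_trans; [apply norm_triangle|]. rewrite norm_scal.
    assert (Rabs th <= eta) by (now apply Rabs_le). unfold M. nra. }
  assert (Heg : 0 < eta * (norm g * norm g)) by (apply Rmult_lt_0_compat; nra).
  (* With this accuracy the linearization error is at most half of [s eta |g|^2], so the sign of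
     [phi] is known at [th = - eta] and [th = eta]. *)
  destruct (Hphi x Hx0 (eta * (norm g * norm g) / (2 * M))) as [d [Hd0 Hdh]];
    [apply Rdiv_lt_0_compat; lra|]. fold g in Hdh.
  set (s := Rmin delta d / (2 * M)).
  assert (Hm : 0 < Rmin delta d) by now apply Rmin_glb_lt.
  assert (Hs : 0 < s) by (apply Rdiv_lt_0_compat; lra).
  assert (HsM : s * M = Rmin delta d / 2) by (unfold s; field; lra).
  pose proof (Rmin_l delta d). pose proof (Rmin_r delta d).
  set (a := vadd x (vscal s t)). set (b := vscal s g).
  assert (Hab : forall th, vadd a (vscal th b) = vadd x (vscal s (vadd t (vscal th g)))).
  { intros th. unfold a, b. vector_eq. }
  assert (Hsmall : forall th, - eta <= th <= eta ->
    norm (vscal s (vadd t (vscal th g))) <= Rmin delta d / 2).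
  { intros th Hth. rewrite norm_scal, Rabs_pos_eq by lra. specialize (Hb th Hth). nra. }
  assert (Hnear : forall th, - eta <= th <= eta -> norm (vsub (vadd a (vscal th b)) x) < delta).
  { intros th Hth. rewrite Hab.
    replace (vsub (vadd x (vscal s (vadd t (vscal th g)))) x)
      with (vscal s (vadd t (vscal th g))) by vector_eq.
    specialize (Hsmall th Hth). lra. }
  assert (Hval : forall th, - eta <= th <= eta ->
    Rabs (phi (vadd a (vscal th b)) - s * th * (norm g * norm g))
      <= s * (eta * (norm g * norm g) / 2)).
  { intros th Hth. rewrite Hab. specialize (Hdh (vscal s (vadd t (vscal th g)))).
    pose proof (Hsmall th Hth) as Hsm. specialize (Hdh ltac:(lra)).
    rewrite phix in Hdh. rewrite inner_scal_r, inner_add_r, inner_scal_r, Ht, <- norm_sqr in Hdh.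
    replace (s * th * (norm g * norm g)) with (s * (0 + th * (norm g * norm g))) by ring.
    rewrite Rminus_0_r in Hdh. eapply Rle_trans; [exact Hdh|].
    rewrite norm_scal, Rabs_pos_eq by lra.
    replace (s * (eta * (norm g * norm g) / 2))
      with (eta * (norm g * norm g) / (2 * M) * (s * M)) by (field; lra).
    apply Rmult_le_compat_l; [left; apply Rdiv_lt_0_compat; lra|].
    apply Rmult_le_compat_l; [lra|]. now apply Hb. }
  assert (Hse : 0 < s * (eta * (norm g * norm g))) by (apply Rmult_lt_0_compat; lra).
  destruct (IVT_interv (fun th => phi (vadd a (vscal th b))) (- eta) eta) as [th [Hth Hz]].
  - intros th Hth. apply derivable_continuous_pt. exists (inner (G (vadd a (vscal th b))) b).
    apply line_derivative, Hphi, Hnear. lra.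
  - lra.
  - pose proof (Hval (- eta) ltac:(lra)) as Hv. apply Rabs_le_inv in Hv. nra.
  - pose proof (Hval eta ltac:(lra)) as Hv. apply Rabs_le_inv in Hv. nra.
  - exists s, th. split; [assumption|]. split; [lra|].
    rewrite <- Hab. apply HS; [apply Hnear; lra|assumption].
Qed.

(** The point [y + (e / 2) n] still lies in [V], which leaves a margin [e / 2]. This determines the
    sign of a normal. *)
Lemma normal_strict_interior (V : X -> Prop) x n y :
  outer_unit_normal V x n -> int_set V y -> inner n (vsub y x) < 0.
Proof.
  intros [Hn HV] [e [He Hy]].
  assert (H : V (vadd y (vscal (e / 2) n))).
  { apply Hy. replace (vsub (vadd y (vscal (e / 2) n)) y) with (vscal (e / 2) n) by vector_eq.
    rewrite norm_scal, Hn, Rabs_pos_eq; lra. }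
  apply HV in H. revert H. rewrite !inner_sub_r, inner_add_r, inner_scal_r, <- norm_sqr, Hn. lra.
Qed.

(** Let [t] be the component of [n] orthogonal to [g = G x], so [<n, t> = |t|^2]. Boundary points in
    directions [t + th g] with [|th| <= eta] give [<n, t> <= eta |<n, g>|] for all small [eta],
    whence [t = 0]. *)
Lemma normal_parallel_gradient (V : X -> Prop) (phi : X -> R) (G : X -> X) x n delta :
  is_closed V -> bdry V x -> outer_unit_normal V x n ->
  0 < delta -> (forall y, norm (vsub y x) < delta -> has_gradient phi y (G y)) ->
  (forall y, norm (vsub y x) < delta -> (bdry V y <-> phi y = 0)) ->
  G x <> vzero -> exists c, n = vscal c (G x).
Proof.
  intros Hcl Sx [Hn HV] Hd Hphi HS HG.
  pose proof (norm_pos _ HG) as Hg. set (g := G x) in *.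
  set (c := inner n g / (norm g * norm g)).
  set (t := vsub n (vscal c g)).
  assert (Ht : inner g t = 0).
  { unfold t. rewrite inner_sub_r, inner_scal_r, <- norm_sqr, inner_sym.
    unfold c. field. lra. }
  exists c. apply inner_sub_eq0. fold t.
  replace (inner t t) with (inner n t)
    by (unfold t at 2; rewrite inner_sub_l, inner_scal_l, Ht; ring).
  apply (le0_of_scaled _ (Rabs (inner n g))). intros eta Heta.
  destruct (tangent_boundary_point (bdry V) phi G x delta t eta) as [s [th [Hs [Hth Hb]]]];
    try assumption; [lra|]. fold g in Hb.
  apply is_closed_bdry in Hb; [|assumption]. apply HV in Hb.
  replace (vsub (vadd x (vscal s (vadd t (vscal th g)))) x)
    with (vscal s (vadd t (vscal th g))) in Hb by vector_eq.
  rewrite inner_scal_r, inner_add_r, inner_scal_r in Hb.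
  assert (H : inner n t + th * inner n g <= 0).
  { apply Rmult_le_reg_l with s; [assumption|]. lra. }
  assert (Rabs (th * inner n g) <= eta * Rabs (inner n g)).
  { rewrite Rabs_mult. apply Rmult_le_compat_r; [apply Rabs_pos|]. now apply Rabs_le. }
  pose proof (Rabs_le_inv _ _ H0). lra.
Qed.

(** Both normals are multiples of one gradient with factors of equal absolute value, and an interior
    point forces equal signs. *)
Theorem outer_unit_normal_unique (V : X -> Prop) x n n' :
  convex_body V -> C1_hypersurface (bdry V) -> bdry V x ->
  outer_unit_normal V x n -> outer_unit_normal V x n' -> n = n'.
Proof.
  intros [Hcl [_ [y0 Hy0]]] HC1 Sx Hn Hn'.
  destruct (HC1 x Sx) as [delta [phi [G [Hd [Hphi [_ [HG HS]]]]]]].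
  destruct (normal_parallel_gradient V phi G x n delta) as [c Hc]; try assumption.
  destruct (normal_parallel_gradient V phi G x n' delta) as [c' Hc']; try assumption.
  pose proof (normal_strict_interior V x n y0 Hn Hy0) as H1.
  pose proof (normal_strict_interior V x n' y0 Hn' Hy0) as H2.
  destruct Hn as [Hn _], Hn' as [Hn' _].
  rewrite Hc, inner_scal_l in H1. rewrite Hc', inner_scal_l in H2.
  rewrite Hc, norm_scal in Hn. rewrite Hc', norm_scal in Hn'.
  set (k := inner (G x) (vsub y0 x)) in *.
  assert (Rabs c = Rabs c').
  { apply Rmult_eq_reg_r with (norm (G x)); [lra|]. apply norm_pos in HG. lra. }
  rewrite Hc, Hc'. f_equal.
  destruct (Rcase_abs c), (Rcase_abs c');
    rewrite ?(Rabs_left c), ?(Rabs_left c'), ?(Rabs_right c), ?(Rabs_right c') in H by assumption;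
    nra.
Qed.

End Normals.

(** * Inner parallel bodies and the equivalence of (1) to (4) *)

(** Here uniqueness of the unit normals takes the place of the [C1] regularity of the boundary. *)
Record smooth_body {X : HilbertSpace} (V : X -> Prop) (N : X -> X) : Prop := {
  body_closed : is_closed V;
  body_convex : convex_set V;
  body_nonempty : exists x, V x;
  body_normal : forall x, bdry V x -> outer_unit_normal V x (N x);
  body_normal_unique : forall x n, bdry V x -> outer_unit_normal V x n -> n = N x
}.

(* The centres of the balls of radius [r] contained in [V]. *)
Definition inner_body {X : HilbertSpace} (V : X -> Prop) (N : X -> X) (r : R) (w : X) : Prop :=
  forall y, bdry V y -> inner (N y) (vsub w y) <= - r.

(* Says that the ball of radius [r] centred at [x - r N(x)] lies in [V] for every boundary
   point [x]; since [1 - <N x, N y> = |N x - N y|^2 / 2], this is (3) when [r = 1 / L]. *)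
Definition rolling {X : HilbertSpace} (V : X -> Prop) (N : X -> X) (r : R) : Prop :=
  forall x y, bdry V x -> bdry V y ->
    r * (1 - inner (N x) (N y)) <= inner (N y) (vsub y x).

Section SmoothBody.
Context {X : HilbertSpace}.
Implicit Types (V : X -> Prop) (N : X -> X) (x y z w p u n : X).

Lemma unit_normal_sqr V N x : smooth_body V N -> bdry V x -> inner (N x) (N x) = 1.
Proof.
  intros HB Sx. destruct (body_normal _ _ HB x Sx) as [H _]. rewrite <- norm_sqr, H. ring.
Qed.

Lemma normal_support V N x y : smooth_body V N -> bdry V x -> V y ->
  inner (N x) (vsub y x) <= 0.
Proof. intros HB Sx. destruct (body_normal _ _ HB x Sx) as [_ H]. apply H. Qed.

Lemma normal_dist V N x y : smooth_body V N -> bdry V x -> bdry V y ->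
  inner (vsub (N x) (N y)) (vsub (N x) (N y)) = 2 * (1 - inner (N x) (N y)).
Proof.
  intros HB Sx Sy. pose proof (unit_normal_sqr V N x HB Sx).
  pose proof (unit_normal_sqr V N y HB Sy).
  rewrite inner_sub_l, !inner_sub_r, (inner_sym X (N y) (N x)). lra.
Qed.

(** The form in which uniqueness is applied: normals obtained from projections or from gradients are
    not normalized. *)
Lemma normal_eq_direction V N x n : smooth_body V N -> bdry V x -> n <> vzero ->
  (forall y, V y -> inner n (vsub y x) <= 0) -> n = vscal (norm n) (N x).
Proof.
  intros HB Sx Hn H. apply norm_pos in Hn.
  rewrite <- (body_normal_unique _ _ HB x (vscal (/ norm n) n) Sx).
  - vector_eq.
  - split.
    + rewrite norm_scal, Rabs_inv, Rabs_pos_eq by lra. field. lra.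
    + intros y Hy. rewrite inner_scal_l. apply H in Hy.
      apply Rinv_0_lt_compat in Hn. nra.
Qed.

Lemma projection_neq V w p : V p -> ~ V w -> vsub w p <> vzero.
Proof. intros Hp Hw H. apply vsub_eq0 in H. now subst. Qed.

Lemma body_projection_normal V N w p : smooth_body V N -> ~ V w -> V p ->
  (forall y, V y -> inner (vsub w p) (vsub y p) <= 0) ->
  bdry V p /\ vsub w p = vscal (norm (vsub w p)) (N p).
Proof.
  intros HB Hw Hp H. pose proof (projection_neq V w p Hp Hw) as Hn.
  assert (Sp : bdry V p) by (now apply supported_bdry with (vsub w p)).
  split; [assumption|]. now apply normal_eq_direction with V.
Qed.

(** A closed convex set is the intersection of its supporting half-spaces: a point outside [V]
    violates the one at its projection, whose normal points towards it. *)
Lemma inner_body0 V N w : smooth_body V N -> (inner_body V N 0 w <-> V w).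
Proof.
  intros HB. split.
  - intros H. apply NNPP. intros Hw.
    destruct (projection_exists V w) as [p [Hp Hpr]]; try apply HB.
    destruct (body_projection_normal V N w p HB Hw Hp Hpr) as [Sp He].
    apply H in Sp as Hi. pose proof (projection_neq V w p Hp Hw) as Hn. apply norm_pos in Hn.
    rewrite He, inner_scal_r, (unit_normal_sqr V N) in Hi by assumption. lra.
  - intros Hw y Sy. rewrite Ropp_0. now apply (normal_support V N).
Qed.

Lemma inner_body_ball V N r w y : smooth_body V N -> inner_body V N r w ->
  norm (vsub y w) <= r -> V y.
Proof.
  intros HB Hw Hy. apply (inner_body0 V N); [assumption|]. intros x Sx.
  pose proof (cauchy_schwarz (N x) (vsub y w)) as HC.
  destruct (body_normal _ _ HB x Sx) as [Hn _]. rewrite Hn in HC.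
  specialize (Hw x Sx). rewrite inner_sub_r in *. lra.
Qed.

Lemma inner_body_closed V N r : smooth_body V N -> is_closed (inner_body V N r).
Proof.
  intros HB w Hw y Sy. apply le_epsilon. intros e He.
  destruct (Hw e He) as [w' [Hw' Hd]]. specialize (Hw' y Sy).
  pose proof (cauchy_schwarz (N y) (vsub w w')) as HC.
  destruct (body_normal _ _ HB y Sy) as [Hn _]. rewrite Hn in HC.
  rewrite inner_sub_r in *. lra.
Qed.

Lemma inner_body_convex V N r : convex_set (inner_body V N r).
Proof.
  intros w w' t Hw Hw' Ht y Sy. specialize (Hw y Sy). specialize (Hw' y Sy).
  rewrite inner_sub_r, inner_add_r, !inner_scal_r in *. nra.
Qed.

Lemma rolling_center V N r x : smooth_body V N -> rolling V N r -> bdry V x ->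
  inner_body V N r (vsub x (vscal r (N x))).
Proof.
  intros HB Hr Sx y Sy. specialize (Hr x y Sx Sy).
  rewrite inner_sub_r in Hr. rewrite !inner_sub_r, inner_scal_r, (inner_sym X (N y) (N x)). lra.
Qed.

Lemma inner_body_nonempty V N r : smooth_body V N -> rolling V N r ->
  exists w, inner_body V N r w.
Proof.
  intros HB Hr. destruct (classic (exists x, bdry V x)) as [[x Sx]|H].
  - exists (vsub x (vscal r (N x))). now apply rolling_center.
  (* With empty boundary, every point belongs to [inner_body] vacuously. *)
  - exists vzero. intros y Sy. exfalso. apply H. now exists y.
Qed.

Lemma rolling0 V N : smooth_body V N -> rolling V N 0.
Proof.
  intros HB x y Sx Sy.
  pose proof (normal_support V N y x HB Sy (is_closed_bdry V x (body_closed _ _ HB) Sx)).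
  rewrite inner_sub_r in *. lra.
Qed.

(* The ray from [p] through [w] cannot stay in [V], as otherwise it would stay in the inner body;
   its exit point [x] satisfies [|x - p| >= r] because the ball around [p] is in [V], while
   [x - r N(x)] is in the inner body, whose projection of [x] is [p]. *)
Lemma inner_body_projection V N r w p : smooth_body V N -> 0 <= r -> rolling V N r ->
  ~ inner_body V N r w -> inner_body V N r p ->
  (forall y, inner_body V N r y -> inner (vsub w p) (vsub y p) <= 0) ->
  exists x, bdry V x /\ p = vsub x (vscal r (N x)) /\
    vsub w p = vscal (norm (vsub w p)) (N x).
Proof.
  intros HB [Hr|<-] Hroll Hw Hp Hpr.
  (* For [r = 0] the inner body is [V] and [p] itself is the boundary point; the ray argument
     divides by [r] at its end. *)
  2: { exists p. rewrite (inner_body0 V N) in Hw, Hp by assumption.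
    destruct (body_projection_normal V N w p HB Hw Hp) as [Sp He].
    - intros y Hy. apply Hpr. now apply (inner_body0 V N).
    - split; [assumption|]. split; [vector_eq|assumption]. }
  pose proof (norm_pos _ (projection_neq _ w p Hp Hw)) as Hk.
  set (k := norm (vsub w p)) in *. set (u := vscal (/ k) (vsub w p)).
  assert (Hwp : vsub w p = vscal k u) by (unfold u; vector_eq).
  assert (Huu : inner u u = 1).
  { unfold u. rewrite inner_scal_l, inner_scal_r, <- norm_sqr. fold k. field. lra. }
  assert (Hun : norm u = 1) by (unfold norm; rewrite Huu; apply sqrt_1).
  assert (Hpu : forall y, inner_body V N r y -> inner u (vsub y p) <= 0).
  { intros y Hy. apply Hpr in Hy. rewrite Hwp, inner_scal_l in Hy.
    apply Rmult_le_reg_l with k; lra. }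
  assert (Hexit : exists y, bdry V y /\ 0 < inner (N y) u).
  { apply NNPP. intros Hno.
    assert (Hin : inner_body V N r (vadd p u)).
    { intros y Sy. assert (Hle : inner (N y) u <= 0).
      { apply Rnot_lt_le. intros Hlt. apply Hno. now exists y. }
      specialize (Hp y Sy). rewrite inner_sub_r in *. rewrite inner_add_r. lra. }
    apply Hpu in Hin. rewrite inner_sub_r, inner_add_r, Huu in Hin. lra. }
  destruct Hexit as [y [Sy Hy]].
  assert (Hball : forall s, 0 <= s <= r -> V (vadd p (vscal s u))).
  { intros s Hs. apply (inner_body_ball V N r p); try assumption.
    replace (vsub (vadd p (vscal s u)) p) with (vscal s u) by vector_eq.
    rewrite norm_scal, Hun, Rabs_pos_eq; lra. }
  destruct (completeness (fun s => V (vadd p (vscal s u)))) as [m [Hub Hlub]].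
  { exists (inner (N y) (vsub y p) / inner (N y) u). intros s Hs.
    apply (normal_support V N y) in Hs; try assumption.
    apply Rmult_le_reg_r with (inner (N y) u); [assumption|].
    replace (inner (N y) (vsub y p) / inner (N y) u * inner (N y) u)
      with (inner (N y) (vsub y p)) by (field; lra).
    rewrite inner_sub_r, inner_add_r, inner_scal_r in Hs. rewrite inner_sub_r. lra. }
  { exists r. apply Hball. lra. }
  assert (Hrm : r <= m) by (apply Hub, Hball; lra).
  set (x := vadd p (vscal m u)).
  assert (Hdist : forall s, norm (vsub (vadd p (vscal s u)) x) = Rabs (s - m)).
  { intros s. unfold x. replace (vsub (vadd p (vscal s u)) (vadd p (vscal m u)))
      with (vscal (s - m) u) by vector_eq.
    rewrite norm_scal, Hun. ring. }
  assert (Sx : bdry V x).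
  { split.
    - intros e He. apply NNPP. intros Hno.
      assert (m <= m - e / 2); [|lra]. apply Hlub. intros s Hs. apply Rnot_lt_le. intros Hlt.
      apply Hno. exists (vadd p (vscal s u)). split; [assumption|].
      rewrite norm_sub_sym, Hdist. apply Hub in Hs. unfold Rabs. destruct (Rcase_abs (s - m)); lra.
    - intros [e [He Hint]].
      assert (m + e / 2 <= m); [|lra]. apply Hub, Hint. rewrite Hdist.
      rewrite Rabs_pos_eq; lra. }
  (* Testing the projection at the centre [x - r N(x)] gives [m <= r <u, N(x)> <= r]. With [r <= m]
     this forces [m = r] and [<u, N(x)> = 1], hence [u = N(x)]. *)
  pose proof (Hpu _ (rolling_center V N r x HB Hroll Sx)) as Hc.
  destruct (body_normal _ _ HB x Sx) as [Hn _].
  pose proof (cauchy_schwarz u (N x)) as HC. rewrite Hun, Hn in HC.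
  unfold x in Hc at 1.
  rewrite !inner_sub_r, inner_add_r, !inner_scal_r, Huu in Hc.
  assert (HuN : r * (1 - inner u (N x)) <= 0) by nra.
  assert (Hm : m = r) by nra.
  assert (HeN : u = N x).
  { apply inner_sub_eq0. pose proof (unit_normal_sqr V N x HB Sx).
    rewrite inner_sub_l, !inner_sub_r, Huu, (inner_sym X (N x) u). nra. }
  exists x. split; [assumption|]. split.
  - rewrite <- HeN. unfold x. rewrite Hm. vector_eq.
  - now rewrite <- HeN.
Qed.

(* If [w] in the ball of radius [k/2], [k = 1/L - r], touching the inner body [C_r] at
   [q = x - r N(x)] from inside were not in [C_r], project it to [p = x' - r N(x')]:
   the Lipschitz bound gives [k |N x' - N x| <= |p - q| <= |w - q|], which is incompatible with
   [<N x', w - q> > 0]. *)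
Lemma rolling_step V N L r : smooth_body V N -> 0 < L -> cond1 V N L ->
  0 <= r < / L -> rolling V N r -> rolling V N (r + (/ L - r) / 2).
Proof.
  intros HB HL H1 Hr Hroll. set (k := / L - r). assert (Hk : 0 < k) by (unfold k; lra).
  assert (Hball : forall x w, bdry V x ->
    norm (vsub w (vsub x (vscal (r + k / 2) (N x)))) <= k / 2 -> inner_body V N r w).
  { intros x w Sx Hw. apply NNPP. intros Hno.
    destruct (projection_exists (inner_body V N r) w) as [p [Hp Hpr]].
    { now apply inner_body_closed. }
    { apply inner_body_convex. }
    { now apply inner_body_nonempty. }
    destruct (inner_body_projection V N r w p) as [x' [Sx' [Hpx Hwp]]]; try tauto.
    pose proof (norm_pos _ (projection_neq _ w p Hp Hno)) as Hn.
    set (q := vsub x (vscal r (N x))).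
    pose proof (Hpr q (rolling_center V N r x HB Hroll Sx)) as Hpq.
    pose proof (unit_normal_sqr V N x HB Sx) as Hxx.
    pose proof (unit_normal_sqr V N x' HB Sx') as Hxx'.
    assert (Hpos : 0 < inner (N x') (vsub w q)).
    { assert (E : inner (N x') (vsub w p) = norm (vsub w p))
        by (rewrite Hwp, inner_scal_r, Hxx' at 1; ring).
      rewrite Hwp, inner_scal_l in Hpq.
      assert (inner (N x') (vsub q p) <= 0) by (apply Rmult_le_reg_l with (norm (vsub w p)); lra).
      rewrite inner_sub_r in *. lra. }
    assert (Hdq : norm (vsub p q) <= norm (vsub w q)).
    { apply sqr_le_norm; [apply norm_ge0|]. rewrite norm_sqr.
      replace (inner (vsub w q) (vsub w q)) with (inner (vsub w p) (vsub w p)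
        - 2 * inner (vsub w p) (vsub q p) + inner (vsub p q) (vsub p q))
        by (expand_inner; ring).
      pose proof (inner_pos X (vsub w p)). lra. }
    assert (HkN : k * norm (vsub (N x') (N x)) <= norm (vsub p q)).
    { specialize (H1 x' x Sx' Sx).
      pose proof (norm_triangle (vsub p q) (vscal r (vsub (N x') (N x)))) as HT.
      replace (vadd (vsub p q) (vscal r (vsub (N x') (N x)))) with (vsub x' x) in HT
        by (rewrite Hpx; unfold q; vector_eq).
      rewrite norm_scal, Rabs_pos_eq in HT by lra.
      assert (/ L * norm (vsub (N x') (N x)) <= norm (vsub x' x)).
      { apply Rmult_le_reg_l with L; [assumption|].
        rewrite <- Rmult_assoc, Rinv_r, Rmult_1_l; lra. }
      unfold k. lra. }
    assert (Hwq : inner (vsub w q) (vsub w q) + k * inner (N x) (vsub w q) <= 0).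
    { replace (vsub w (vsub x (vscal (r + k / 2) (N x))))
        with (vadd (vsub w q) (vscal (k / 2) (N x))) in Hw by (unfold q; vector_eq).
      pose proof (norm_ge0 (vadd (vsub w q) (vscal (k / 2) (N x)))) as H0.
      assert (Hsq : norm (vadd (vsub w q) (vscal (k / 2) (N x))) *
        norm (vadd (vsub w q) (vscal (k / 2) (N x))) <= k / 2 * (k / 2)) by nra.
      rewrite norm_sqr, inner_add_l, !inner_add_r, !inner_scal_l, !inner_scal_r, Hxx,
        (inner_sym X (vsub w q) (N x)) in Hsq. lra. }
    pose proof (cauchy_schwarz (vsub (N x') (N x)) (vsub w q)) as HC.
    rewrite inner_sub_l in HC. rewrite <- norm_sqr in Hwq.
    pose proof (norm_ge0 (vsub w q)).
    (* With [v = w - q], the term [k <N(x') - N(x), v>] is at most [|v|^2], while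
       [k <N(x), v> <= - |v|^2]; their sum contradicts [Hpos]. *)
    assert (k * inner (N x') (vsub w q) <= 0); [|nra].
    assert (k * norm (vsub (N x') (N x)) * norm (vsub w q) <= norm (vsub w q) * norm (vsub w q))
      by (apply Rmult_le_compat_r; lra).
    nra. }
  intros x y Sx Sy. pose proof (unit_normal_sqr V N y HB Sy) as Hyy.
  destruct (body_normal _ _ HB y Sy) as [Hn _].
  set (c := vsub x (vscal (r + k / 2) (N x))).
  (* The point of the small ball farthest in the direction [N(y)] gives the sharpest constraint at
     [y]. *)
  assert (Hy : inner_body V N r (vadd c (vscal (k / 2) (N y)))).
  { apply (Hball x); [assumption|]. fold c.
    replace (vsub (vadd c (vscal (k / 2) (N y))) c) with (vscal (k / 2) (N y)) by vector_eq.
    rewrite norm_scal, Hn, Rabs_pos_eq; lra. }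
  specialize (Hy y Sy). unfold c in Hy.
  rewrite inner_sub_r, inner_add_r, inner_sub_r, !inner_scal_r, Hyy in Hy.
  rewrite inner_sub_r, (inner_sym X (N x) (N y)). fold k. lra.
Qed.

(** The inequality is affine in the radius, so it passes to the limit for each fixed pair [x],
    [y]. *)
Lemma rolling_limit V N L : 0 < L -> (forall e, 0 < e -> exists r, / L - e < r /\ rolling V N r) ->
  smooth_body V N -> rolling V N (/ L).
Proof.
  intros HL H HB x y Sx Sy.
  set (d := 1 - inner (N x) (N y)).
  assert (Hd : 0 <= d).
  { pose proof (normal_dist V N x y HB Sx Sy) as E. fold d in E.
    pose proof (inner_pos X (vsub (N x) (N y))). lra. }
  apply le_epsilon. intros e He.
  destruct (H (e / (d + 1))) as [r [Hr Hroll]]; [apply Rdiv_lt_0_compat; lra|].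
  specialize (Hroll x y Sx Sy). fold d in Hroll.
  assert (e / (d + 1) * d <= e).
  { apply Rmult_le_reg_r with (d + 1); [lra|].
    replace (e / (d + 1) * d * (d + 1)) with (e * d) by (field; lra). nra. }
  nra.
Qed.

(** Each step halves the gap to [1 / L], so the radii are [(1 - 2^-j) / L]. *)
Lemma lipschitz_rolling V N L : smooth_body V N -> 0 < L -> cond1 V N L -> rolling V N (/ L).
Proof.
  intros HB HL H1. assert (HL' : 0 < / L) by now apply Rinv_0_lt_compat.
  assert (Hn : forall j, rolling V N (/ L * (1 - (1 / 2) ^ j))).
  { induction j as [|j IH].
    - replace (/ L * (1 - (1 / 2) ^ 0)) with 0 by (simpl; ring). now apply rolling0.
    - replace (/ L * (1 - (1 / 2) ^ S j)) with
        (/ L * (1 - (1 / 2) ^ j) + (/ L - / L * (1 - (1 / 2) ^ j)) / 2) by (simpl; field; lra).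
      apply rolling_step; try assumption.
      assert (0 < (1 / 2) ^ j <= 1) by (split; [apply pow_lt; lra|rewrite <- (pow1 j) at 2; apply pow_incr; lra]).
      nra. }
  apply rolling_limit; try assumption. intros e He.
  destruct (pow_lt_1_zero (1 / 2) ltac:(rewrite Rabs_pos_eq; lra) (e * L)) as [j Hn0]; [nra|].
  exists (/ L * (1 - (1 / 2) ^ j)). split; [|apply Hn].
  specialize (Hn0 j (le_n j)). rewrite Rabs_pos_eq in Hn0 by (apply pow_le; lra).
  assert (/ L * (1 / 2) ^ j < / L * (e * L)) by (apply Rmult_lt_compat_l; lra).
  replace (/ L * (e * L)) with e in * by (field; lra). lra.
Qed.

Lemma rolling_cond3 V N L : smooth_body V N -> 0 < L ->
  (rolling V N (/ L) <-> cond3 V N L).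
Proof.
  intros HB HL.
  assert (E : forall x y, bdry V x -> bdry V y ->
    / (2 * L) * norm (vsub (N x) (N y)) ^ 2 = / L * (1 - inner (N x) (N y))).
  { intros x y Sx Sy. simpl. rewrite Rmult_1_r, norm_sqr, (normal_dist V N) by assumption.
    field. lra. }
  split; intros H x y Sx Sy; specialize (H x y Sx Sy); rewrite E in * by assumption; lra.
Qed.

(** Adding the inequality to the one with [x] and [y] exchanged gives [d^2 / L <= <N(x) - N(y), x -
    y> <= d |x - y|]; then cancel [d] unless it is zero. *)
Lemma cond3_cond1 V N L : 0 < L -> cond3 V N L -> cond1 V N L.
Proof.
  intros HL H x y Sx Sy. pose proof (H x y Sx Sy) as Hxy. pose proof (H y x Sy Sx) as Hyx.
  rewrite (norm_sub_sym (N y) (N x)) in Hyx.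
  set (d := norm (vsub (N x) (N y))) in *.
  pose proof (norm_ge0 (vsub x y)). assert (Hd : 0 <= d) by apply norm_ge0.
  assert (Hmono : / L * (d * d) <= inner (vsub (N x) (N y)) (vsub x y)).
  { replace (/ L * (d * d)) with (/ (2 * L) * d ^ 2 + / (2 * L) * d ^ 2) by (field; lra).
    rewrite inner_sub_l, !inner_sub_r. rewrite inner_sub_r in Hxy, Hyx. lra. }
  pose proof (cauchy_schwarz (vsub (N x) (N y)) (vsub x y)) as HC. fold d in HC.
  assert (d * d <= d * (L * norm (vsub x y))).
  { replace (d * d) with (L * (/ L * (d * d))) by (field; lra).
    apply Rle_trans with (L * (d * norm (vsub x y))); [apply Rmult_le_compat_l|]; lra. }
  destruct Hd as [Hd|<-]; [apply Rmult_le_reg_l with d; lra|].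
  apply Rmult_le_pos; lra.
Qed.

(** The centre is [x - r N(x)]. At another contact point [y] the equality case of Cauchy-Schwarz
    gives [y - x = r (N(y) - N(x))], so [|y - x| <= r L |y - x|] with [r L < 1]. *)
Lemma rolling_cond2 V N L : smooth_body V N -> 0 < L -> cond1 V N L ->
  rolling V N (/ L) -> cond2 V L.
Proof.
  intros HB HL H1 Hroll r Hr x Sx.
  assert (Hr' : rolling V N r).
  { intros a b Sa Sb. specialize (Hroll a b Sa Sb).
    pose proof (normal_dist V N a b HB Sa Sb) as E.
    pose proof (inner_pos X (vsub (N a) (N b))). nra. }
  set (z := vsub x (vscal r (N x))). exists z.
  pose proof (rolling_center V N r x HB Hr' Sx) as Hz. fold z in Hz.
  destruct (body_normal _ _ HB x Sx) as [Hn _].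
  split; [intros y; now apply (inner_body_ball V N)|].
  intros y. unfold sphere. split.
  - intros [Hy Sy]. specialize (Hz y Sy).
    pose proof (unit_normal_sqr V N y HB Sy) as Hyy.
    assert (He : vsub y z = vscal r (N y)).
    { apply aligned_eq; try assumption. rewrite inner_sub_r in *. lra. }
    assert (Hyx : vsub y x = vscal r (vsub (N y) (N x))).
    { replace (vsub y x) with (vsub (vsub y z) (vscal r (N x))) by (unfold z; vector_eq).
      rewrite He. vector_eq. }
    specialize (H1 y x Sy Sx). pose proof (norm_ge0 (vsub (N y) (N x))).
    pose proof (f_equal norm Hyx) as Hnorm. rewrite norm_scal, Rabs_pos_eq in Hnorm by lra.
    assert (HrL : r * L < 1) by (replace 1 with (/ L * L) by (field; lra); nra).
    pose proof (norm_ge0 (vsub y x)).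
    assert (norm (vsub y x) = 0) by nra.
    apply inner_sub_eq0. rewrite <- norm_sqr. nra.
  - intros ->. split; [|assumption]. unfold z.
    replace (vsub x (vsub x (vscal r (N x)))) with (vscal r (N x)) by vector_eq.
    rewrite norm_scal, Hn, Rabs_pos_eq; lra.
Qed.

(** The centre [z] of a ball in [V] touching at [x] satisfies [<N(x), x - z> >= r = |x - z|], so it
    must be [x - r N(x)]. *)
Lemma cond2_rolling V N L : smooth_body V N -> 0 < L -> cond2 V L -> rolling V N (/ L).
Proof.
  intros HB HL H2. assert (HL' : 0 < / L) by now apply Rinv_0_lt_compat.
  apply rolling_limit; try assumption. intros e He.
  (* The second term of the maximum keeps [r] positive when [e] is large. *)
  set (r := Rmax (/ L - e / 2) (/ L / 2)).
  assert (Hr : 0 < r < / L).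
  { split; [apply Rlt_le_trans with (/ L / 2); [lra|apply Rmax_r]|apply Rmax_lub_lt; lra]. }
  exists r. split; [pose proof (Rmax_l (/ L - e / 2) (/ L / 2)); fold r in H; lra|].
  assert (Hin : forall z, (forall y, cball z r y -> V y) -> inner_body V N r z).
  { intros z Hz y Sy. pose proof (unit_normal_sqr V N y HB Sy) as Hyy.
    destruct (body_normal _ _ HB y Sy) as [Hn _].
    assert (Hv : V (vadd z (vscal r (N y)))).
    { apply Hz. unfold cball.
      replace (vsub (vadd z (vscal r (N y))) z) with (vscal r (N y)) by vector_eq.
      rewrite norm_scal, Hn, Rabs_pos_eq; lra. }
    apply (normal_support V N y) in Hv; try assumption.
    rewrite inner_sub_r, inner_add_r, inner_scal_r, Hyy in Hv. rewrite inner_sub_r. lra. }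
  intros x y Sx Sy. destruct (H2 r Hr x Sx) as [z [Hz Hzx]].
  destruct (proj2 (Hzx x) eq_refl) as [Hxz _]. unfold sphere in Hxz.
  specialize (Hin z Hz). pose proof (unit_normal_sqr V N x HB Sx) as Hxx.
  assert (He1 : vsub x z = vscal r (N x)).
  { specialize (Hin x Sx). apply aligned_eq; try assumption. rewrite inner_sub_r in *. lra. }
  specialize (Hin y Sy).
  replace z with (vsub x (vsub x z)) in Hin by vector_eq.
  rewrite He1, !inner_sub_r, inner_scal_r, (inner_sym X (N y) (N x)) in Hin.
  rewrite inner_sub_r. lra.
Qed.

Lemma rolling_cond4 V N L : smooth_body V N -> 0 < L -> rolling V N (/ L) -> cond4 V N L.
Proof.
  intros HB HL Hroll. assert (HL' : 0 < / L) by now apply Rinv_0_lt_compat.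
  set (C := inner_body V N (/ L)).
  destruct (choice_fun X X (fun w p => C p /\ forall y, C y -> inner (vsub w p) (vsub y p) <= 0))
    as [P HP].
  { intros w. apply projection_exists; [now apply inner_body_closed|apply inner_body_convex|].
    now apply inner_body_nonempty. }
  set (A := fun w => vsub w (P w)).
  assert (HA : forall x y, inner (A x) (vsub (P y) (P x)) <= 0)
    by (intros x y; apply (HP x), (HP y)).
  (* The additive constant makes [F] equal to [1] exactly at distance [1 / L] from [C]. *)
  set (F := fun w => L / 2 * inner (A w) (A w) + (1 - / (2 * L))).
  set (G := fun w => vscal L (A w)).
  (* The gap is [L / 2] times [|A y - A x|^2 - 2 <A x, P y - P x>], and the last inner product is
     nonpositive. *)
  assert (Hsub : forall x y, F x + inner (G x) (vsub y x) <= F y).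
  { intros x y. unfold F, G. rewrite inner_scal_l.
    enough (0 <= inner (A y) (A y) - inner (A x) (A x) - 2 * inner (A x) (vsub y x)) by nra.
    replace (inner (A y) (A y) - inner (A x) (A x) - 2 * inner (A x) (vsub y x)) with
      (inner (vsub (A y) (A x)) (vsub (A y) (A x)) - 2 * inner (A x) (vsub (P y) (P x)))
      by (unfold A; expand_inner; ring).
    pose proof (inner_pos X (vsub (A y) (A x))). specialize (HA x y). lra. }
  (* A boundary point [x] projects onto [x - N(x) / L]: that centre lies in [C], while the
     constraint at [x] on [P x] gives [<N(x), A x> >= 1 / L]. *)
  assert (Hcenter : forall x, bdry V x -> A x = vscal (/ L) (N x)).
  { intros x Sx. pose proof (rolling_center V N (/ L) x HB Hroll Sx) as Hc. fold C in Hc.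
    destruct (HP x) as [HPx Hpr]. apply Hpr in Hc. fold (A x) in Hc.
    specialize (HPx x Sx). pose proof (unit_normal_sqr V N x HB Sx) as Hxx.
    apply inner_sub_eq0.
    replace (vsub (vsub x (vscal (/ L) (N x))) (P x)) with (vsub (A x) (vscal (/ L) (N x)))
      in Hc by (unfold A; vector_eq).
    replace (vsub (P x) x) with (vopp (A x)) in HPx by (unfold A; vector_eq).
    rewrite inner_opp_r in HPx.
    rewrite inner_sub_l, !(inner_sub_r _ (A x)), !inner_scal_l, !inner_scal_r, Hxx.
    rewrite inner_sub_r, inner_scal_r in Hc. nra. }
  exists F, G. split; [|split; [|split; [|split]]].
  - intros x y t Ht. set (z := vadd (vscal t x) (vscal (1 - t) y)).
    pose proof (Hsub z x) as Hx. pose proof (Hsub z y) as Hy.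
    assert (E : t * inner (G z) (vsub x z) + (1 - t) * inner (G z) (vsub y z) = 0).
    { rewrite <- !inner_scal_r, <- inner_add_r.
      replace (vadd (vscal t (vsub x z)) (vscal (1 - t) (vsub y z))) with (vzero : X)
        by (unfold z; vector_eq).
      apply inner_zero_r. }
    nra.
  - intros x e He. exists (e / L). split; [now apply Rdiv_lt_0_compat|]. intros h Hh.
    pose proof (Hsub x (vadd x h)) as Hlow.
    replace (vsub (vadd x h) x) with h in Hlow by vector_eq.
    (* The point [P x] competes in the distance from [x + h] to [C]. *)
    assert (Hup : F (vadd x h) <= F x + inner (G x) h + L / 2 * inner h h).
    { unfold F, G. rewrite inner_scal_l.
      pose proof (HA (vadd x h) x) as Ha.
      enough (inner (A (vadd x h)) (A (vadd x h)) <=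
        inner (A x) (A x) + 2 * inner (A x) h + inner h h) by nra.
      replace (inner (A x) (A x) + 2 * inner (A x) h + inner h h) with
        (inner (A (vadd x h)) (A (vadd x h))
         - 2 * inner (A (vadd x h)) (vsub (P x) (P (vadd x h)))
         + inner (vsub (P x) (P (vadd x h))) (vsub (P x) (P (vadd x h))))
        by (unfold A; expand_inner; ring).
      pose proof (inner_pos X (vsub (P x) (P (vadd x h)))). lra. }
    rewrite <- norm_sqr in Hup. pose proof (norm_ge0 h).
    assert (L * norm h <= e).
    { replace e with (L * (e / L)) by (field; lra). apply Rmult_le_compat_l; lra. }
    apply Rabs_le. nra.
  - intros x y. unfold G.
    replace (vsub (vscal L (A x)) (vscal L (A y))) with (vscal L (vsub (A x) (A y)))
      by vector_eq.
    rewrite norm_scal, Rabs_pos_eq by lra. apply Rmult_le_compat_l; [lra|].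
    apply norm_le_sqr; [apply norm_ge0|]. rewrite norm_sqr.
    (* [A] is nonexpansive: in [x - y = (A x - A y) + (P x - P y)] the two summands have nonnegative
       inner product. *)
    replace (inner (vsub x y) (vsub x y)) with (inner (vsub (A x) (A y)) (vsub (A x) (A y))
      - 2 * inner (A x) (vsub (P y) (P x)) - 2 * inner (A y) (vsub (P x) (P y))
      + inner (vsub (P x) (P y)) (vsub (P x) (P y))) by (unfold A; expand_inner; ring).
    pose proof (HA x y). pose proof (HA y x).
    pose proof (inner_pos X (vsub (P x) (P y))). lra.
  - intros x. split.
    + intros Sx. unfold F. rewrite (Hcenter x Sx), inner_scal_l, inner_scal_r.
      rewrite (unit_normal_sqr V N x HB Sx). field. lra.
    + intros HF. unfold F in HF.
      assert (HAx : inner (A x) (A x) = / L * / L).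
      { apply Rmult_eq_reg_l with (L / 2); [|lra].
        replace (L / 2 * (/ L * / L)) with (/ (2 * L)) by (field; lra). lra. }
      destruct (HP x) as [HPx Hpr].
      assert (Hn : norm (A x) = / L) by (unfold norm; rewrite HAx; apply sqrt_square; lra).
      (* As [A x] is nonzero, [x] is outside [C], and both [x] and the boundary point [x'] equal
         [P x + N(x') / L]. *)
      destruct (inner_body_projection V N (/ L) x (P x)) as [x' [Sx' [He1 He2]]];
        try assumption; [lra| |].
      { intros Hx. apply Hpr in Hx. fold (A x) in Hx. nra. }
      fold (A x) in He2. rewrite Hn in He2.
      replace x with x'; [assumption|].
      replace x' with (vadd (P x) (vscal (/ L) (N x'))) by (rewrite He1 at 1; vector_eq).
      rewrite <- He2. unfold A. vector_eq.
  - intros x Sx. unfold G. rewrite (Hcenter x Sx). vector_eq.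
Qed.

Lemma cond4_cond3 V N L : 0 < L -> cond4 V N L -> cond3 V N L.
Proof.
  intros HL [F [G [HF [HG [Hlip [HS HN]]]]]] x y Sx Sy.
  pose proof (cocoercive_bound F G L x y HL HF HG Hlip) as H.
  rewrite (proj1 (HS x) Sx), (proj1 (HS y) Sy), (HN x Sx), (HN y Sy) in H.
  simpl. rewrite Rmult_1_r, norm_sqr.
  rewrite inner_sub_r in *. lra.
Qed.

End SmoothBody.

(** * The Minkowski functional of a bounded body containing a ball around the origin *)

Section Minkowski.
Context {X : HilbertSpace}.
Context (V : X -> Prop) (N : X -> X) (rho M : R).
Context (HB : smooth_body V N) (Hrho : 0 < rho) (HM : 0 < M).
Context (Hball : forall y, norm y <= rho -> V y) (Hbound : forall y, V y -> norm y <= M).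
Implicit Types x y h p q : X.

Notation mu := (minkowski V).

(** Scaling by [t = (|x| + 1) / rho] brings [x] into the ball, so the default value of [Inf] never
    occurs. *)
Lemma minkowski_is_inf x : is_inf (fun t => 0 < t /\ V (vscal (/ t) x)) (mu x).
Proof.
  unfold minkowski, Inf. destruct (excluded_middle_informative _) as [H|H].
  - exact (proj2_sig (constructive_indefinite_description _ H)).
  - exfalso. apply H. apply glb_exists with 0; [|intros t [Ht _]; lra].
    pose proof (norm_ge0 x) as Hx.
    assert (Ht : 0 < (norm x + 1) / rho) by (apply Rdiv_lt_0_compat; lra).
    exists ((norm x + 1) / rho). split; [assumption|].
    apply Hball. rewrite norm_scal, Rabs_inv, Rabs_pos_eq by lra.
    replace (/ ((norm x + 1) / rho) * norm x) with (rho * norm x / (norm x + 1)) by (field; lra).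
    apply Rmult_le_reg_r with (norm x + 1); [lra|].
    replace (rho * norm x / (norm x + 1) * (norm x + 1)) with (rho * norm x) by (field; lra).
    nra.
Qed.

Lemma minkowski_le x t : 0 < t -> V (vscal (/ t) x) -> mu x <= t.
Proof. intros Ht Hx. now apply (minkowski_is_inf x). Qed.

Lemma minkowski_ge x b : (forall t, 0 < t -> V (vscal (/ t) x) -> b <= t) -> b <= mu x.
Proof. intros H. apply (minkowski_is_inf x). intros t [Ht Hx]. now apply H. Qed.

(** Admissible [t] close to [mu x] give points of [V] close to [x / mu x]; were that point interior,
    some smaller [t] would be admissible. *)
Lemma minkowski_scaled_bdry x : 0 < mu x -> bdry V (vscal (/ mu x) x).
Proof.
  intros Hmu. pose proof (norm_ge0 x) as Hx. set (m := mu x) in *. split.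
  - intros e He. apply NNPP. intros Hno.
    assert (Hd : 0 < e * m * m / (norm x + 1)) by
      (apply Rdiv_lt_0_compat; [repeat apply Rmult_lt_0_compat|]; lra).
    (* For [m <= t < m + d], the points [x / t] and [x / m] are at distance
       [(t - m) |x| / (m t) <= d |x| / m^2 < e]. *)
    set (d := e * m * m / (norm x + 1)) in *.
    assert (m + d <= m); [|lra].
    unfold m at 2. apply minkowski_ge. intros t Ht HVt. apply Rnot_lt_le. intros Hlt.
    apply Hno. exists (vscal (/ t) x). split; [assumption|].
    assert (Hmt : m <= t) by now apply minkowski_le.
    replace (vsub (vscal (/ m) x) (vscal (/ t) x)) with (vscal (/ m - / t) x) by vector_eq.
    rewrite norm_scal, Rabs_pos_eq by
      (apply Rge_le, Rge_minus, Rle_ge, Rinv_le_contravar; lra).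
    replace (/ m - / t) with ((t - m) / (m * t)) by (field; lra).
    apply Rmult_lt_reg_r with (m * t); [nra|].
    replace ((t - m) / (m * t) * norm x * (m * t)) with ((t - m) * norm x) by (field; lra).
    assert ((t - m) * norm x <= d * norm x) by (apply Rmult_le_compat_r; lra).
    assert (Hde : d * (norm x + 1) = e * m * m) by (unfold d; field; lra).
    assert (e * m * m <= e * (m * t)) by (rewrite Rmult_assoc; apply Rmult_le_compat_l; nra).
    lra.
  - intros [e [He Hint]].
    set (d := e / (2 * (norm (vscal (/ m) x) + 1))).
    pose proof (norm_ge0 (vscal (/ m) x)) as Hn.
    assert (Hd : 0 < d) by (apply Rdiv_lt_0_compat; lra).
    assert (Hlt : m / (1 + d) < m).
    { apply Rmult_lt_reg_r with (1 + d); [lra|].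
      replace (m / (1 + d) * (1 + d)) with m by (field; lra). nra. }
    assert (m <= m / (1 + d)); [|lra]. unfold m at 1. apply minkowski_le.
    { apply Rdiv_lt_0_compat; lra. }
    apply Hint.
    replace (vsub (vscal (/ (m / (1 + d))) x) (vscal (/ m) x)) with (vscal d (vscal (/ m) x))
      by vector_eq.
    rewrite norm_scal, Rabs_pos_eq by lra.
    apply Rle_lt_trans with (d * (norm (vscal (/ m) x) + 1)); [nra|].
    unfold d. replace (e / (2 * (norm (vscal (/ m) x) + 1)) * (norm (vscal (/ m) x) + 1))
      with (e / 2) by (field; lra). lra.
Qed.

(** Support inequality at the point [rho N(p)]. It keeps the denominators [<N(p), p>] away from
    zero. *)
Lemma normal_position_lower p : bdry V p -> rho <= inner (N p) p.
Proof.
  intros Sp. destruct (body_normal _ _ HB p Sp) as [Hn _].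
  assert (Hv : V (vscal rho (N p))) by (apply Hball; rewrite norm_scal, Hn, Rabs_pos_eq; lra).
  apply (normal_support V N p) in Hv; try assumption.
  rewrite inner_sub_r, inner_scal_r, (unit_normal_sqr V N p HB Sp) in Hv. lra.
Qed.

Lemma minkowski_support p y : bdry V p -> inner (N p) y <= mu y * inner (N p) p.
Proof.
  intros Sp. pose proof (normal_position_lower p Sp) as Hc. set (c := inner (N p) p) in *.
  assert (H : inner (N p) y / c <= mu y).
  { apply minkowski_ge. intros t Ht HV.
    apply (normal_support V N p) in HV; try assumption.
    rewrite inner_sub_r, inner_scal_r in HV. fold c in HV.
    apply Rmult_le_reg_r with c; [lra|].
    replace (inner (N p) y / c * c) with (t * (/ t * inner (N p) y)) by (field; lra).
    apply Rmult_le_compat_l; lra. }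
  replace (inner (N p) y) with (inner (N p) y / c * c) by (field; lra).
  apply Rmult_le_compat_r; lra.
Qed.

Lemma minkowski_bdry p : bdry V p -> mu p = 1.
Proof.
  intros Sp. apply Rle_antisym.
  - apply minkowski_le; [lra|]. rewrite Rinv_1, vscal_1.
    apply is_closed_bdry; [apply HB|assumption].
  - pose proof (normal_position_lower p Sp). pose proof (minkowski_support p p Sp).
    apply Rmult_le_reg_r with (inner (N p) p); lra.
Qed.

Definition minkowski_gradient x : X :=
  let p := vscal (/ mu x) x in vscal (/ inner (N p) p) (N p).

Lemma minkowski_gradient_le x y : 0 < mu x -> inner (minkowski_gradient x) y <= mu y.
Proof.
  intros Hx. unfold minkowski_gradient. set (p := vscal (/ mu x) x).
  assert (Sp : bdry V p) by now apply minkowski_scaled_bdry.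
  pose proof (normal_position_lower p Sp). rewrite inner_scal_l.
  apply Rmult_le_reg_l with (inner (N p) p); [lra|].
  rewrite <- Rmult_assoc, Rinv_r, Rmult_1_l, Rmult_comm by lra. now apply minkowski_support.
Qed.

Lemma minkowski_gradient_self x : 0 < mu x -> inner (minkowski_gradient x) x = mu x.
Proof.
  intros Hx. unfold minkowski_gradient. set (p := vscal (/ mu x) x).
  assert (Sp : bdry V p) by now apply minkowski_scaled_bdry.
  pose proof (normal_position_lower p Sp) as Hp.
  replace x with (vscal (mu x) p) at 1 by (unfold p; vector_eq).
  rewrite inner_scal_l, inner_scal_r. field. lra.
Qed.

Lemma minkowski_gradient_norm x : 0 < mu x -> norm (minkowski_gradient x) <= / rho.
Proof.
  intros Hx. unfold minkowski_gradient. set (p := vscal (/ mu x) x).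
  assert (Sp : bdry V p) by now apply minkowski_scaled_bdry.
  pose proof (normal_position_lower p Sp) as Hp.
  destruct (body_normal _ _ HB p Sp) as [Hn _].
  rewrite norm_scal, Hn, Rabs_inv, Rabs_pos_eq, Rmult_1_r by lra.
  apply Rinv_le_contravar; lra.
Qed.

Lemma minkowski_upper_increment x y : 0 < mu y ->
  mu y - mu x <= inner (minkowski_gradient y) (vsub y x).
Proof.
  intros Hy. pose proof (minkowski_gradient_le y x Hy).
  rewrite inner_sub_r, minkowski_gradient_self by assumption. lra.
Qed.

Lemma minkowski_increment_bound x y : 0 < mu y -> mu y - mu x <= / rho * norm (vsub y x).
Proof.
  intros Hy. eapply Rle_trans; [now apply minkowski_upper_increment|].
  eapply Rle_trans; [apply cauchy_schwarz|].
  apply Rmult_le_compat_r; [apply norm_ge0|now apply minkowski_gradient_norm].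
Qed.

Lemma scaled_point_lipschitz alpha x y : 0 < alpha -> alpha <= mu x -> alpha <= mu y ->
  norm (vsub (vscal (/ mu x) x) (vscal (/ mu y) y))
    <= / alpha * (1 + / rho * M) * norm (vsub x y).
Proof.
  intros Ha Hx Hy. set (q := vscal (/ mu y) y).
  assert (Hq : norm q <= M).
  { apply Hbound, is_closed_bdry; [apply HB|]. apply minkowski_scaled_bdry. lra. }
  assert (Hd : Rabs (mu y - mu x) <= / rho * norm (vsub x y)).
  { apply Rabs_le.
    pose proof (minkowski_increment_bound y x ltac:(lra)).
    pose proof (minkowski_increment_bound x y ltac:(lra)) as H0.
    rewrite norm_sub_sym in H0. lra. }
  (* Substituting [y = mu(y) q] isolates the variation of [mu], which is [1 / rho]-Lipschitz. *)
  replace (vsub (vscal (/ mu x) x) q)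
    with (vscal (/ mu x) (vadd (vsub x y) (vscal (mu y - mu x) q)))
    by (unfold q; vector_eq).
  rewrite norm_scal, Rabs_inv, Rabs_pos_eq by lra.
  rewrite Rmult_assoc. apply Rmult_le_compat.
  - left. apply Rinv_0_lt_compat. lra.
  - apply norm_ge0.
  - apply Rinv_le_contravar; lra.
  - eapply Rle_trans; [apply norm_triangle|]. rewrite norm_scal.
    assert (Rabs (mu y - mu x) * norm q <= / rho * norm (vsub x y) * M).
    { apply Rmult_le_compat; [apply Rabs_pos|apply norm_ge0|assumption|assumption]. }
    lra.
Qed.

Lemma scaled_normal_lipschitz L p q : 0 < L -> cond1 V N L -> bdry V p -> bdry V q ->
  norm (vsub (vscal (/ inner (N p) p) (N p)) (vscal (/ inner (N q) q) (N q)))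
    <= / rho * (L + (L * M + 1) * / rho) * norm (vsub p q).
Proof.
  intros HL H1 Sp Sq.
  pose proof (normal_position_lower p Sp) as Hc. pose proof (normal_position_lower q Sq) as Hd.
  destruct (body_normal _ _ HB p Sp) as [Hnp _]. destruct (body_normal _ _ HB q Sq) as [Hnq _].
  assert (HqM : norm q <= M) by (apply Hbound, is_closed_bdry; [apply HB|assumption]).
  specialize (H1 p q Sp Sq). pose proof (norm_ge0 (vsub p q)) as Hpq.
  assert (Hdc : Rabs (inner (N q) q - inner (N p) p) <= (L * M + 1) * norm (vsub p q)).
  { replace (inner (N q) q - inner (N p) p)
      with (- (inner (vsub (N p) (N q)) q + inner (N p) (vsub p q)))
      by (rewrite inner_sub_l, inner_sub_r; ring).
    rewrite Rabs_Ropp. eapply Rle_trans; [apply Rabs_triang|].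
    pose proof (cauchy_schwarz_abs (vsub (N p) (N q)) q) as Ha.
    pose proof (cauchy_schwarz_abs (N p) (vsub p q)) as Hb. rewrite Hnp in Hb.
    assert (norm (vsub (N p) (N q)) * norm q <= L * norm (vsub p q) * M).
    { apply Rmult_le_compat; [apply norm_ge0|apply norm_ge0|assumption|assumption]. }
    lra. }
  set (c := inner (N p) p) in *. set (d := inner (N q) q) in *.
  replace (vsub (vscal (/ c) (N p)) (vscal (/ d) (N q)))
    with (vscal (/ c) (vadd (vsub (N p) (N q)) (vscal ((d - c) * / d) (N q)))) by vector_eq.
  rewrite norm_scal, Rabs_inv, Rabs_pos_eq by lra.
  rewrite Rmult_assoc. apply Rmult_le_compat.
  - left. apply Rinv_0_lt_compat. lra.
  - apply norm_ge0.
  - apply Rinv_le_contravar; lra.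
  - eapply Rle_trans; [apply norm_triangle|].
    rewrite norm_scal, Hnq, Rabs_mult, Rabs_inv, (Rabs_pos_eq d) by lra.
    assert (Rabs (d - c) * / d <= (L * M + 1) * norm (vsub p q) * / rho).
    { apply Rmult_le_compat; [apply Rabs_pos| |assumption|apply Rinv_le_contravar; lra].
      left. apply Rinv_0_lt_compat. lra. }
    lra.
Qed.

Lemma minkowski_gradient_lipschitz L alpha : 0 < L -> cond1 V N L -> 0 < alpha ->
  exists K, 0 < K /\ forall x y, alpha <= mu x -> alpha <= mu y ->
    norm (vsub (minkowski_gradient x) (minkowski_gradient y)) <= K * norm (vsub x y).
Proof.
  intros HL H1 Ha.
  assert (Hr : 0 < / rho) by now apply Rinv_0_lt_compat.
  assert (Hra : 0 < / alpha) by now apply Rinv_0_lt_compat.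
  assert (HLM : 0 < L * M) by now apply Rmult_lt_0_compat.
  assert (HK1 : 0 < / rho * (L + (L * M + 1) * / rho)) by (apply Rmult_lt_0_compat; nra).
  assert (HK2 : 0 < / alpha * (1 + / rho * M)) by (apply Rmult_lt_0_compat; nra).
  exists (/ rho * (L + (L * M + 1) * / rho) * (/ alpha * (1 + / rho * M))).
  split; [now apply Rmult_lt_0_compat|]. intros x y Hx Hy.
  eapply Rle_trans.
  - apply (scaled_normal_lipschitz L (vscal (/ mu x) x) (vscal (/ mu y) y)); try assumption;
      apply minkowski_scaled_bdry; lra.
  - rewrite (Rmult_assoc _ (/ alpha * _)). apply Rmult_le_compat_l; [lra|].
    now apply scaled_point_lipschitz.
Qed.

(** The subgradient inequalities at [x] and [x + h] squeeze the error between [0] and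
    [<G(x + h) - G(x), h> <= K |h|^2], where [G] is [minkowski_gradient]. The bound on [h] keeps
    [mu (x + h)] above [mu x / 2], where [K] applies. *)
Lemma minkowski_has_gradient L x : 0 < L -> cond1 V N L -> 0 < mu x ->
  has_gradient mu x (minkowski_gradient x).
Proof.
  intros HL H1 Hx e He.
  destruct (minkowski_gradient_lipschitz L (mu x / 2) HL H1) as [K [HK HKl]]; [lra|].
  exists (Rmin (rho * (mu x / 2)) (e / K)). split.
  { apply Rmin_glb_lt; [apply Rmult_lt_0_compat; lra|now apply Rdiv_lt_0_compat]. }
  intros h Hh.
  pose proof (Rlt_le_trans _ _ _ Hh (Rmin_l _ _)) as Hh1.
  pose proof (Rlt_le_trans _ _ _ Hh (Rmin_r _ _)) as Hh2.
  pose proof (norm_ge0 h) as Hh0.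
  assert (Hxh : vsub x (vadd x h) = vopp h) by vector_eq.
  assert (Hhx : vsub (vadd x h) x = h) by vector_eq.
  assert (Hy : mu x / 2 <= mu (vadd x h)).
  { pose proof (minkowski_increment_bound (vadd x h) x Hx) as Hi. rewrite Hxh, norm_opp in Hi.
    assert (/ rho * norm h <= / rho * (rho * (mu x / 2))).
    { apply Rmult_le_compat_l; [left; now apply Rinv_0_lt_compat|lra]. }
    replace (/ rho * (rho * (mu x / 2))) with (mu x / 2) in * by (field; lra). lra. }
  pose proof (minkowski_upper_increment (vadd x h) x Hx) as Hlow.
  rewrite Hxh, inner_opp_r in Hlow.
  pose proof (minkowski_upper_increment x (vadd x h) ltac:(lra)) as Hup. rewrite Hhx in Hup.
  pose proof (cauchy_schwarz (vsub (minkowski_gradient (vadd x h)) (minkowski_gradient x)) h)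
    as HC. rewrite inner_sub_l in HC.
  specialize (HKl (vadd x h) x Hy ltac:(lra)). rewrite Hhx in HKl.
  assert (HKe : K * norm h <= e).
  { replace e with (K * (e / K)) by (field; lra). apply Rmult_le_compat_l; lra. }
  assert (norm (vsub (minkowski_gradient (vadd x h)) (minkowski_gradient x)) * norm h
    <= e * norm h) by (apply Rmult_le_compat_r; lra).
  assert (0 <= e * norm h) by nra.
  apply Rabs_le. lra.
Qed.

Lemma cond1_cond5 L : 0 < L -> cond1 V N L -> cond5 V.
Proof.
  intros HL H1 alpha Ha.
  destruct (minkowski_gradient_lipschitz L alpha HL H1 Ha) as [K [_ HK]].
  exists minkowski_gradient, K. split.
  - intros x Hx. apply minkowski_has_gradient with L; try assumption. lra.
  - intros x y Hx Hy. apply HK; lra.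
Qed.

(** On segments from [x] into [V] one has [mu <= 1], so [g] is an outward normal direction. Towards
    the origin [mu] is at most [1 - t], so [1 <= <g, x> <= M |g|]. *)
Lemma gradient_normal x g : bdry V x -> has_gradient mu x g ->
  / M <= norm g /\ g = vscal (norm g) (N x).
Proof.
  intros Sx Hg.
  assert (Vx : V x) by (apply is_closed_bdry; [apply HB|assumption]).
  assert (Hsup : forall y, V y -> inner g (vsub y x) <= 0).
  { intros y Hy. apply (gradient_upper_slope mu x); [assumption|]. intros t Ht.
    rewrite (minkowski_bdry x Sx), Rmult_0_r, Rplus_0_r. apply minkowski_le; [lra|].
    rewrite Rinv_1, vscal_1.
    replace (vadd x (vscal t (vsub y x))) with (vadd (vscal t y) (vscal (1 - t) x)) by vector_eq.
    apply (body_convex _ _ HB); try assumption. lra. }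
  assert (Hgx : 1 <= inner g x).
  { enough (inner g (vopp x) <= -1) by (rewrite inner_opp_r in *; lra).
    apply (gradient_upper_slope mu x); [assumption|]. intros t Ht.
    rewrite (minkowski_bdry x Sx). destruct (Req_dec t 1) as [->|Ht1].
    (* At [t = 1] the scale [1 - t] vanishes and is not admissible, so the value at the origin is
       bounded by every [e > 0] instead. *)
    - replace (vadd x (vscal 1 (vopp x))) with (vzero : X) by vector_eq.
      apply le_epsilon. intros e He. apply minkowski_le; [lra|].
      replace (vscal _ vzero) with (vzero : X) by vector_eq.
      apply Hball. rewrite norm_zero. lra.
    - apply minkowski_le; [lra|].
      replace (vscal _ _) with x; [assumption|].
      vector_eq. }
  pose proof (Rle_trans _ _ _ Hgx (cauchy_schwarz g x)) as HC.
  pose proof (Hbound x Vx) as Hx. pose proof (norm_ge0 g) as Hg0.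
  assert (HgM : / M <= norm g).
  { apply Rmult_le_reg_r with M; [assumption|]. rewrite Rinv_l by lra. nra. }
  split; [assumption|]. apply normal_eq_direction with V; try assumption.
  intros ->. rewrite norm_zero in HgM. apply Rinv_0_lt_compat in HM. lra.
Qed.

(** Since [mu = 1] on the boundary, [alpha = 1] suffices. With [a = |G x| >= 1 / M] and [b = |G y|],
    [a (N(x) - N(y)) = (G x - G y) + (b - a) N(y)] has norm at most [2 |G x - G y|]. *)
Lemma cond5_cond1 : cond5 V -> exists L, 0 < L /\ cond1 V N L.
Proof.
  intros H5. destruct (H5 1 Rlt_0_1) as [G [K [HG HK]]].
  pose proof (Rabs_pos K) as HK0.
  (* [Rabs K + 1] makes the constant positive, as [K] carries no sign condition. *)
  exists (2 * M * (Rabs K + 1)). split; [repeat apply Rmult_lt_0_compat; lra|].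
  intros x y Sx Sy. pose proof (minkowski_bdry x Sx) as Hx. pose proof (minkowski_bdry y Sy) as Hy.
  destruct (gradient_normal x (G x) Sx) as [Ha HGx]; [apply HG; lra|].
  destruct (gradient_normal y (G y) Sy) as [Hb HGy]; [apply HG; lra|].
  specialize (HK x y ltac:(lra) ltac:(lra)).
  destruct (body_normal _ _ HB y Sy) as [Hny _].
  set (a := norm (G x)) in *. set (b := norm (G y)) in *.
  pose proof (norm_ge0 (vsub x y)) as Hxy.
  assert (HKa : norm (vsub (G x) (G y)) <= (Rabs K + 1) * norm (vsub x y)).
  { pose proof (Rle_abs K). nra. }
  assert (Hab : Rabs (b - a) <= norm (vsub (G x) (G y))).
  { pose proof (norm_triangle (vsub (G x) (G y)) (G y)) as H1.
    replace (vadd (vsub (G x) (G y)) (G y)) with (G x) in H1 by vector_eq.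
    pose proof (norm_triangle (vsub (G y) (G x)) (G x)) as H2.
    replace (vadd (vsub (G y) (G x)) (G x)) with (G y) in H2 by vector_eq.
    rewrite (norm_sub_sym (G y)) in H2. fold a b in H1, H2. apply Rabs_le. lra. }
  assert (HaN : a * norm (vsub (N x) (N y)) <= 2 * ((Rabs K + 1) * norm (vsub x y))).
  { assert (Ha0 : 0 <= a) by apply norm_ge0.
    replace (a * norm (vsub (N x) (N y))) with (norm (vscal a (vsub (N x) (N y))))
      by (rewrite norm_scal, Rabs_pos_eq; lra).
    replace (vscal a (vsub (N x) (N y))) with (vadd (vsub (G x) (G y)) (vscal (b - a) (N y)))
      by (rewrite HGx, HGy; vector_eq).
    eapply Rle_trans; [apply norm_triangle|]. rewrite norm_scal, Hny. lra. }
  pose proof (norm_ge0 (vsub (N x) (N y))) as Hn.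
  replace (norm (vsub (N x) (N y))) with (M * (/ M * norm (vsub (N x) (N y)))) by (field; lra).
  assert (/ M * norm (vsub (N x) (N y)) <= a * norm (vsub (N x) (N y)))
    by (apply Rmult_le_compat_r; lra).
  replace (2 * M * (Rabs K + 1) * norm (vsub x y))
    with (M * (2 * ((Rabs K + 1) * norm (vsub x y)))) by ring.
  apply Rmult_le_compat_l; lra.
Qed.

End Minkowski.

(** * Assembly of the equivalences *)

Theorem theorem2p5 (X : HilbertSpace) (V : X -> Prop) (N : X -> X) :
  convex_body V ->
  C1_hypersurface (bdry V) ->
  (forall x, bdry V x -> outer_unit_normal V x (N x)) ->
  (forall L : R, 0 < L ->
    (cond1 V N L <-> cond2 V L) /\ (cond1 V N L <-> cond3 V N L) /\
    (cond1 V N L <-> cond4 V N L)) /\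
  (bounded_set V -> int_set V vzero ->
    ((exists L : R, 0 < L /\ cond1 V N L /\ cond2 V L /\ cond3 V N L /\ cond4 V N L)
     <-> cond5 V)).
Proof.
  intros Hbody HC1 HN.
  assert (HB : smooth_body V N).
  { pose proof Hbody as [Hcl [Hcv [x0 Hx0]]]. split; try assumption.
    - exists x0. destruct Hx0 as [e [He H]]. apply H.
      replace (vsub x0 x0) with (vzero : X) by vector_eq. now rewrite norm_zero.
    - intros x n Sx Hn. apply outer_unit_normal_unique with V x; auto. }
  assert (H12 : forall L, 0 < L -> cond1 V N L -> cond2 V L)
    by (intros; apply (rolling_cond2 V N); auto using lipschitz_rolling).
  assert (H13 : forall L, 0 < L -> cond1 V N L -> cond3 V N L)
    by (intros; apply rolling_cond3; auto using lipschitz_rolling).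
  assert (H14 : forall L, 0 < L -> cond1 V N L -> cond4 V N L)
    by (intros; apply rolling_cond4; auto using lipschitz_rolling).
  split.
  - intros L HL. split; [|split]; split; auto.
    + intros H2. apply cond3_cond1; [assumption|]. apply rolling_cond3; auto using cond2_rolling.
    + now apply cond3_cond1.
    + intros H4. apply cond3_cond1; [assumption|]. now apply cond4_cond3.
  - intros [M HM] [e [He Hint]].
    (* The radius is halved because [int_set] provides an open ball. *)
    assert (Hball : forall y, norm y <= e / 2 -> V y).
    { intros y Hy. apply Hint. replace (vsub y vzero) with y by vector_eq. lra. }
    assert (HM' : forall y, V y -> norm y <= Rabs M + 1).
    { intros y Hy. apply HM in Hy. pose proof (Rle_abs M). lra. }
    pose proof (Rabs_pos M).
    split.
    + intros [L [HL [H1 _]]].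
      apply (cond1_cond5 V N (e / 2) (Rabs M + 1)) with L; auto; lra.
    + intros H5.
      destruct (cond5_cond1 V N (e / 2) (Rabs M + 1)) as [L [HL H1]]; auto; try lra.
      exists L. auto 10.
Qed.
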